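(* Let $\mathbb{F}_q$ be a finite field of characteristic $p$ and let $m\geq 2$ be an integer with $\gcd(m,p)=1$. Then there exist a tower $\mathcal{F}/\mathbb{F}_q=(F_k/\mathbb{F}_q)_{k\geq0}$ and a strictly increasing sequence $(n_i)_{i\geq 0}$ of positive integers with $n_0=1$ such that: (i) $B_{n_i}(F_k)\geq p^{k-i}$ for all $0\leq i\leq k$; (ii) $g(F_k)\geq\frac{m-1}{2}(p^k-1)$ for all $k\geq 0$.
   Context: A tower over $\mathbb{F}_q$ is a sequence $(F_k/\mathbb{F}_q)_{k\ge0}$ of algebraic function fields with $\mathbb{F}_q$ algebraically closed in each $F_k$, each $F_{k+1}/F_k$ finite separable with $F_k\subsetneq F_{k+1}$, and genus $g(F_k)\to\infty$ as $k\to\infty$. $B_n(F_k)$ denotes the number of places of degree $n$ of $F_k/\mathbb{F}_q$. *)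

(* Defs.v *)
From HB Require Import structures.
From mathcomp Require Import all_boot all_order all_algebra all_field.
From Stdlib Require List.
Set Implicit Arguments.
Unset Strict Implicit.
Unset Printing Implicit Defensive.
Import Order.TTheory GRing.Theory Num.Theory.
Local Open Scope ring_scope.

Section FunctionField.
Variables (K F : fieldType) (iota : {rmorphism K -> F}).

Definition function_field : Prop :=
  exists x : F,
    (forall f : {poly K}, (map_poly iota f).[x] = 0 -> f = 0) /\
    exists (r : nat) (b : 'I_r -> F),
      forall y : F, exists f g : 'I_r -> {poly K},
        (forall i, g i != 0) /\
        y = \sum_i ((map_poly iota (f i)).[x] / (map_poly iota (g i)).[x]) * b i.

Definition const_closed : Prop :=
  forall y : F, (exists f : {poly K}, f != 0 /\ root (map_poly iota f) y) ->
    exists c : K, y = iota c.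

Definition valring (O : F -> Prop) : Prop :=
  O 0 /\ O 1 /\ (forall a b, O a -> O b -> O (a - b)) /\
  (forall a b, O a -> O b -> O (a * b)) /\ (forall c, O (iota c)) /\
  (exists z, ~ O z) /\ (forall z, z != 0 -> O z \/ O z^-1).

Definition maxideal (O : F -> Prop) (z : F) : Prop :=
  O z /\ ~ (z != 0 /\ O z^-1).
Definition unitO (O : F -> Prop) (u : F) : Prop := u != 0 /\ O u /\ O u^-1.
Definition prime_elt (O : F -> Prop) (t : F) : Prop :=
  maxideal O t /\ forall z, maxideal O z -> exists w, O w /\ z = t * w.

Definition val_ge (O : F -> Prop) (z : F) (a : int) : Prop :=
  z = 0 \/ exists (t u : F) (n : int),
    [/\ prime_elt O t, unitO O u, a <= n & z = t ^ n * u].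

Definition place_deg (O : F -> Prop) (d : nat) : Prop :=
  exists y : 'I_d -> F, (forall i, O (y i)) /\
    (forall a, O a -> exists c : 'I_d -> K,
        maxideal O (a - \sum_i iota (c i) * y i)) /\
    (forall c : 'I_d -> K, maxideal O (\sum_i iota (c i) * y i) ->
        forall i, c i = 0).

Definition places_ge (d N : nat) : Prop :=
  exists P : 'I_N -> (F -> Prop),
    (forall i, valring (P i) /\ place_deg (P i) d) /\
    (forall i j, P i = P j -> i = j).

(* a divisor: a finite list of (place, multiplicity, degree of the place) *)
Definition divisor := seq ((F -> Prop) * int * nat).
Definition is_divisor (A : divisor) : Prop :=
  (forall O a d, List.In (O, a, d) A -> valring O /\ place_deg O d) /\
  List.NoDup (map (fun e => e.1.1) A).
Definition div_deg (A : divisor) : int :=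
  \sum_(e <- A) e.1.2 * (e.2 : int).
Definition in_L (A : divisor) (x : F) : Prop :=
  forall O, valring O ->
    (forall a d, List.In (O, a, d) A -> val_ge O x (- a)) /\
    ((forall a d, ~ List.In (O, a, d) A) -> val_ge O x 0).
Definition ell_le (A : divisor) (N : nat) : Prop :=
  forall y : 'I_N.+1 -> F, (forall i, in_L A (y i)) ->
    exists c : 'I_N.+1 -> K, (exists i, c i != 0) /\
      \sum_i iota (c i) * y i = 0.
(* g(F) >= G, where g(F) = max_A (deg A - l(A) + 1) *)
Definition genus_ge (G : rat) : Prop :=
  exists (A : divisor) (N : nat),
    [/\ is_divisor A, ell_le A N & G <= ((div_deg A - N%:Z + 1)%:~R : rat)].

End FunctionField.

Section Ext.
Variables (E L : fieldType) (emb : {rmorphism E -> L}).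
Definition finite_ext : Prop :=
  exists (r : nat) (b : 'I_r -> L),
    forall y : L, exists c : 'I_r -> E, y = \sum_i emb (c i) * b i.
Definition separable_ext : Prop :=
  forall y : L, exists f : {poly E},
    [/\ f != 0, separable_poly f & root (map_poly emb f) y].
Definition proper_ext : Prop := exists y : L, forall z : E, emb z != y.
End Ext.

Definition is_tower (K : fieldType) (F : nat -> fieldType)
  (iota : forall k, {rmorphism K -> F k})
  (emb : forall k, {rmorphism F k -> F k.+1}) : Prop :=
  (forall k, function_field (iota k) /\ const_closed (iota k)) /\
  (forall k c, emb k (iota k c) = iota k.+1 c) /\
  (forall k, [/\ finite_ext (emb k), separable_ext (emb k) & proper_ext (emb k)]) /\
  (forall G : nat, exists k0, forall k, (k0 <= k)%N -> genus_ge (iota k) G%:R).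

(* Main.v *)
Require Import Defs.
From HB Require Import structures.
From mathcomp Require Import all_boot all_order all_algebra all_field.
From mathcomp Require Import generic_quotient boolp.
From mathcomp Require classical_sets.
From mathcomp Require Import ring lra zify.
Set Implicit Arguments.
Unset Strict Implicit.
Unset Printing Implicit Defensive.
Import Order.TTheory GRing.Theory Num.Theory.
Local Open Scope ring_scope.

(* Put [f_j = x^(p^(s+1)+1) + x^(p^s+p) - 2 x^(p^s+1)] with [s = m+1+j] and let [F_k] be
   [K(x, y_0, ..., y_(k-1))] with [y_j^p - y_j = f_j], an elementary abelian extension
   of [K(x)] of degree [p^k].

   Places.  Let [Q_0 = x], and for [i > 0] let [Q_i] be an irreducible factor of
   [X^(q^r) - X - 1], [r = p^(i-1)]; it has degree [n_i = p^i].  As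
   [f_j = wp(x^N) - (x^p - x)^N], where [wp(z) = z^p - z] and [N = p^s + 1], and as
   [x^p - x] is fixed by the [q^r]-Frobenius modulo [Q_i], the trace of [f_j] from
   [K[x]/Q_i] to the prime field is zero, so that [Q_i] splits completely in every
   [F_k], into [p^k] places of degree [n_i].

   Genus.  Let [A] be [m] times the sum of the [p^k] places above [x = 0].  Then
   [x^m L(A)] is stable under the Galois group, which acts unipotently.  If it contained
   an element outside [K(x)], it would contain some [w = sum_j c_j y_j + e] with
   [c_j] in [K[x]] of degree at most [m], not all zero, and [e] in [K[x]]; but the pole
   order of [w^p] at infinity is then too large, because the degrees of the [f_j] are
   prime to [p] and grow fast.  Hence [l(A) = m+1] and [g >= m p^k - m].

   Places are produced by Chevalley's extension theorem: a maximal subring avoiding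
   [u^-1] is a valuation ring. *)

(** * Valuation rings *)

Section ValuationRings.
Variables (K F : fieldType) (iota : {rmorphism K -> F}) (O : F -> Prop).
Hypothesis hO : valring iota O.

Lemma valring0 : O 0. Proof. by case: hO. Qed.
Lemma valring1 : O 1. Proof. by case: hO => _ []. Qed.
Lemma valringB a b : O a -> O b -> O (a - b).
Proof. by case: hO => _ [_ [h _]]; apply: h. Qed.
Lemma valringM a b : O a -> O b -> O (a * b).
Proof. by case: hO => _ [_ [_ [h _]]]; apply: h. Qed.
Lemma valring_const c : O (iota c).
Proof. by case: hO => _ [_ [_ [_ [h _]]]]; apply: h. Qed.
Lemma valring_inv z : ~ O z -> O z^-1.
Proof.
have [-> h|z0 h] := eqVneq z 0; first by rewrite invr0; exact: valring0.
by case: hO => _ [_ [_ [_ [_ [_ /(_ z z0)]]]]] [].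
Qed.
Lemma valringN a : O a -> O (- a).
Proof. by move=> Oa; rewrite -sub0r; apply: valringB => //; exact: valring0. Qed.
Lemma valringD a b : O a -> O b -> O (a + b).
Proof. by move=> Oa Ob; rewrite -[b]opprK; apply/valringB/valringN. Qed.
Lemma valringX a n : O a -> O (a ^+ n).
Proof.
move=> Oa; elim: n => [|n IH]; first by rewrite expr0; exact: valring1.
by rewrite exprS; apply: valringM.
Qed.
Lemma valring_sum (I : Type) (r : seq I) (P : pred I) (G : I -> F) :
  (forall i, P i -> O (G i)) -> O (\sum_(i <- r | P i) G i).
Proof. by move=> h; apply: big_ind => //; [exact: valring0|exact: valringD]. Qed.

Lemma maxidealM a b : O a -> maxideal O b -> maxideal O (a * b).
Proof.
move=> Oa [Ob nb]; split; first exact: valringM.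
case; rewrite mulf_eq0 negb_or => /andP[a0 b0] Oab; apply: nb; split => //.
suff -> : b^-1 = a * (a * b)^-1 by exact: valringM.
by rewrite invfM mulrA divff // mul1r.
Qed.
Lemma maxideal_inv z : ~ O z -> maxideal O z^-1.
Proof. by move=> nOz; split; [exact: valring_inv|rewrite invrK => -[]]. Qed.
Lemma maxideal0 : maxideal O 0.
Proof. by split; [exact: valring0|rewrite eqxx => -[]]. Qed.
Lemma maxideal1 : ~ maxideal O 1.
Proof. by case=> _; apply; rewrite oner_eq0 invr1; split => //; exact: valring1. Qed.
(** One of [a / b], [b / a] lies in [O], so the larger of the two elements can be factored out of
    the difference. *)
Lemma maxidealB a b : maxideal O a -> maxideal O b -> maxideal O (a - b).
Proof.
move=> ma mb.
have [->|a0] := eqVneq a 0.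
  by rewrite sub0r -mulN1r; apply: maxidealM => //; apply/valringN/valring1.
have [->|b0] := eqVneq b 0; first by rewrite subr0.
have [Oab|/valring_inv] := EM (O (a / b)).
  rewrite -[a](divfK b0) -[X in _ - X]mul1r -mulrBl; apply: maxidealM => //.
  by apply: valringB => //; exact: valring1.
rewrite invf_div => Oba; rewrite -[b](divfK a0) -[X in X - _]mul1r -mulrBl.
by apply: maxidealM => //; apply: valringB => //; exact: valring1.
Qed.
Lemma maxidealN a : maxideal O a -> maxideal O (- a).
Proof. by move=> ma; rewrite -sub0r; apply: maxidealB => //; exact: maxideal0. Qed.
Lemma maxidealD a b : maxideal O a -> maxideal O b -> maxideal O (a + b).
Proof. by move=> ma mb; rewrite -[b]opprK; apply/maxidealB/maxidealN. Qed.
Lemma maxideal_sum (I : Type) (r : seq I) (P : pred I) (G : I -> F) :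
  (forall i, P i -> maxideal O (G i)) -> maxideal O (\sum_(i <- r | P i) G i).
Proof. by move=> h; apply: big_ind => //; [exact: maxideal0|exact: maxidealD]. Qed.
Lemma maxideal_unit a : O a -> ~ maxideal O a -> O a^-1.
Proof.
move=> Oa na; apply: contrapT => /maxideal_inv; rewrite invrK; exact: na.
Qed.
Lemma maxideal_prime a b : O a -> O b -> maxideal O (a * b) ->
  maxideal O a \/ maxideal O b.
Proof.
move=> Oa Ob mab; have [|na] := EM (maxideal O a); [by left|right].
have a0 : a != 0 by apply/eqP=> a0; apply: na; rewrite a0; exact: maxideal0.
by rewrite -[b](mulKf a0); apply: maxidealM => //; exact: maxideal_unit.
Qed.
Lemma maxideal_prime_prod (I : Type) (r : seq I) (G : I -> F) :
  (forall i, O (G i)) -> maxideal O (\prod_(i <- r) G i) ->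
  exists i, maxideal O (G i).
Proof.
move=> OG; elim: r => [|i r IH]; first by rewrite big_nil => /maxideal1.
rewrite big_cons => /maxideal_prime; case=> //.
- by apply: big_ind => //; [exact: valring1|exact: valringM].
- by exists i.
Qed.
Lemma maxidealX a n : (0 < n)%N -> maxideal O a -> maxideal O (a ^+ n).
Proof.
by case: n => // n _ ma; rewrite exprSr; apply: maxidealM => //; apply/valringX; case: ma.
Qed.

(** If [z] had a pole, dividing by [z^p] would write 1 as a sum of elements of the maximal ideal.
    The coefficient [g] is 1 at finite places and a power of [1/x] at infinity, where the root is
    rescaled first. *)
Lemma valring_AS p g z : (1 < p)%N -> O g -> O (z ^+ p - g * z) -> O z.
Proof.
move=> p1 Og Oz; apply: contrapT => nOz; have mz := maxideal_inv nOz.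
have z0 : z != 0 by apply/eqP=> z0; apply: nOz; rewrite z0; exact: valring0.
apply: maxideal1.
have -> : 1 = (z ^+ p - g * z) * z^-1 ^+ p + g * z^-1 ^+ p.-1.
  rewrite mulrBl -exprMn divff // expr1n.
  case: p p1 {Oz} => // p p1 /=; rewrite [z^-1 ^+ p.+1]exprS mulrA mulfK //.
  by rewrite subrK.
apply: maxidealD; apply: maxidealM => //; apply: maxidealX => //; first exact: ltnW.
by rewrite -subn1 subn_gt0.
Qed.

Lemma maxideal_const c : maxideal O (iota c) -> c = 0.
Proof.
case=> _ nc; apply/eqP; apply: contraT => c0; case: nc; rewrite fmorph_eq0 c0.
by split=> //; rewrite -fmorphV; exact: valring_const.
Qed.

(** At a pole of [y], dividing the equation by the top power of [y] would put the leading
    coefficient, a nonzero constant, in the maximal ideal. *)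
Lemma valring_algebraic (f : {poly K}) y : f != 0 -> root (map_poly iota f) y -> O y.
Proof.
move=> f0 /rootP fy; apply: contrapT => nOy; have my := maxideal_inv nOy.
have y0 : y != 0 by apply/eqP=> y0; apply: nOy; rewrite y0; exact: valring0.
have: size f != 0 by rewrite size_poly_eq0.
move: f0; rewrite -lead_coef_eq0 => /eqP f0 sf; apply: f0; apply: maxideal_const.
move: fy sf; rewrite horner_coef size_map_poly lead_coefE.
case: (size f) => [|n] //= + _.
rewrite big_ord_recr coef_map /= => /eqP; rewrite addrC addr_eq0 => /eqP ef.
rewrite -[iota _](mulfK (expf_neq0 n y0)) ef mulNr; apply: maxidealN.
rewrite big_distrl /=; apply: maxideal_sum => i _; rewrite -mulrA; apply: maxidealM.
  by rewrite coef_map; exact: valring_const.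
have -> : y ^+ i / y ^+ n = y^-1 ^+ (n - i).
  rewrite expfB_cond ?exprVn ?invrK 1?mulrC //.
  by rewrite invr_eq0 (negPf y0) add0n ltnW.
by apply: maxidealX; rewrite // subn_gt0.
Qed.
End ValuationRings.

(** * Chevalley's extension theorem *)

Section Chevalley.
Variables (K F : fieldType) (iota : {rmorphism K -> F}) (A : F -> Prop) (u : F).
Hypotheses (Aiota : forall c, A (iota c)) (AB : forall a b, A a -> A b -> A (a - b))
  (AM : forall a b, A a -> A b -> A (a * b)) (Au : A u) (nAu : ~ A u^-1).

Let subring_avoiding (B : F -> Prop) :=
  [/\ (forall a, A a -> B a), (forall a b, B a -> B b -> B (a - b)),
      (forall a b, B a -> B b -> B (a * b)) & ~ B u^-1].

Lemma exists_maximal_avoiding : exists B, subring_avoiding B /\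
  forall C, subring_avoiding C -> (forall z, B z -> C z) -> forall z, C z -> B z.
Proof.
(* Sets are taken up to union with [A], so that the empty chain, whose union must also qualify,
   stands for [A] itself. *)
pose P (B : classical_sets.set F) := subring_avoiding (fun z => B z \/ A z).
case: (@classical_sets.Zorn_bigcup F P) => [Fm FP tot|B [PB maxB]].
  pose U z := A z \/ exists2 X, Fm X & X z \/ A z.
  have closed (op : F -> F -> F) : (forall a b, A a -> A b -> A (op a b)) ->
     (forall X, Fm X -> forall a b, X a \/ A a -> X b \/ A b -> X (op a b) \/ A (op a b)) ->
     forall a b, U a -> U b -> U (op a b).
    move=> Aop Xop a b [Aa|[X FX Xa]] [Ab|[Y FY Yb]].
    - by left; apply: Aop.
    - by right; exists Y => //; apply: Xop => //; right.
    - by right; exists X => //; apply: Xop => //; right.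
    have [XY|YX] := tot _ _ FX FY.
      by right; exists Y => //; apply: Xop => //; case: Xa => [/XY|]; [left|right].
    by right; exists X => //; apply: Xop => //; case: Yb => [/YX|]; [left|right].
  have UE z : ((classical_sets.bigcup Fm (fun X => X)) z \/ A z) <-> U z.
    split=> [[[X FX Xz]|Az]|[Az|[X FX [Xz|Az]]]]; [|by left|by right| |by right].
      by right; exists X => //; left.
    by left; exists X.
  rewrite /P; split.
  - by move=> a Aa; right.
  - move=> a b /UE Ua /UE Ub; apply/UE; apply: (closed (fun a b => a - b)) => //.
    by move=> X /FP [].
  - move=> a b /UE Ua /UE Ub; apply/UE; apply: (closed (fun a b => a * b)) => //.
    by move=> X /FP [].
  - by move=> /UE [//|[X /FP [_ _ _ h] /h]].
exists (fun z => B z \/ A z); split=> // C hC BC z Cz.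
apply: contrapT => nBz.
apply: (maxB C).
  split; first by move=> t Bt; apply: BC; left.
  by move=> CB; apply: nBz; left; apply: CB.
rewrite /P; case: hC => AC CB CM nCu; split=> [a Aa|a b|a b|[|/AC]] //.
- by right.
- by move=> [Ca|/AC Ca] [Cb|/AC Cb]; left; apply: CB.
- by move=> [Ca|/AC Ca] [Cb|/AC Cb]; left; apply: CM.
Qed.

(** A maximal [B] is a valuation ring: if neither [z] nor [z^-1] were in [B], then [u^-1] would be a
    polynomial over [B] in each of them, and each of the two expressions could be used to shorten
    the other. *)
Lemma exists_valring : exists O, [/\ valring iota O, (forall a, A a -> O a) & ~ O u^-1].
Proof.
have [B [[AsB BB BM nBu] maxB]] := exists_maximal_avoiding.
have B1 : B 1 by apply: AsB; rewrite -(rmorph1 iota).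
have B0 : B 0 by rewrite -(subrr 1); apply: BB.
have BN a : B a -> B (- a) by move=> Ba; rewrite -sub0r; apply: BB.
have BD a b : B a -> B b -> B (a + b) by move=> Ba Bb; rewrite -[b]opprK; apply/BB/BN.
have BX a n : B a -> B (a ^+ n).
  by move=> Ba; elim: n => [|n IH]; rewrite ?expr0 // exprS; apply: BM.
have Bu := AsB _ Au.
have u0 : u != 0 by apply/eqP => u0; apply: nBu; rewrite u0 invr0.
pose adj z t := exists P : {poly F}, (forall i, B P`_i) /\ t = P.[z].
have adjoin z : ~ B z -> adj z u^-1.
  move=> nBz; apply: contrapT => nadj; apply: nBz; apply: (maxB (adj z)).
  - split=> // [a /AsB Ba|_ _ [P [hP ->]] [Q [hQ ->]]|_ _ [P [hP ->]] [Q [hQ ->]]].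
    + by exists a%:P; split=> [i|]; rewrite ?hornerC // coefC; case: eqP.
    + by exists (P - Q); split=> [i|]; rewrite ?hornerE // coefB; apply: BB.
    + exists (P * Q); split=> [i|]; rewrite ?hornerE // coefM.
      by apply: big_ind => // j _; apply: BM.
  - by move=> a Ba; exists a%:P; split=> [i|]; rewrite ?hornerC // coefC; case: eqP.
  - by exists 'X; split=> [i|]; rewrite ?hornerX // coefX; case: eqP.
(* With [v = 1 - u c] not invertible in [B], [u^-1] would be a polynomial in [v^-1]. Clearing
   denominators by a power of [v], which has the form [1 - u d], puts [u^-1] in [B]. *)
have unit1 c : B c -> B (1 - u * c)^-1.
  move=> Bc; apply: contrapT => /adjoin [P [hP eP]]; set v := 1 - u * c in eP.
  have Bv : B v by apply/BB/BM.
  have v0 : v != 0.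
    rewrite subr_eq0; apply/eqP => h; apply: nBu.
    by rewrite -(mulKf u0 c) -h mulr1 in Bc.
  have [d Bd ed] : exists2 d, B d & v ^+ size P = 1 - u * d.
    elim: (size P) => [|n [d Bd ed]]; first by exists 0; rewrite // mulr0 subr0.
    exists (d + c - u * c * d); last by rewrite exprS ed /v; ring.
    by apply: BB; [apply: BD|apply/BM/Bd/BM].
  have [b Bb eb] : exists2 b, B b & u^-1 * v ^+ size P = b.
    exists (\sum_(i < size P) P`_i * v ^+ (size P - i)) => //.
      by apply: big_ind => // i _; apply: BM => //; apply: BX.
    rewrite eP horner_coef big_distrl; apply: eq_bigr => i _ /=.
    rewrite -mulrA exprVn; congr (_ * _).
    by rewrite mulrC -expfB_cond // (negPf v0) add0n ltnW.
  apply: nBu; suff -> : u^-1 = b + d by apply: BD.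
  by rewrite -eb ed mulrBr mulr1 mulKf // subrK.
pose deg z n := exists P : {poly F}, [/\ forall i, B P`_i, (size P <= n)%N & u^-1 = P.[z]].
(* Descent on the sum of the two sizes; the situation is symmetric under [z |-> z^-1], so the longer
   expression may be taken to be the one in [z]. *)
have degP N n k z : (n + k <= N)%N -> z != 0 -> deg z n -> deg z^-1 k -> False.
  elim: N n k z => [|N IH] n k z le_nkN z0 dn dk.
    have [P [_ sP eP]] := dn; move: sP; have -> : n = 0%N by lia.
    rewrite leqn0 size_poly_eq0 => /eqP P0; move: eP; rewrite P0 horner0.
    by apply/eqP; rewrite invr_eq0.
  wlog le_kn : n k z z0 dn dk le_nkN / (k <= n)%N.
    move=> wl; have [|/ltnW lt_nk] := leqP k n; first exact: (wl n k z).
    by apply: (wl k n z^-1) => //; rewrite ?invr_eq0 ?invrK 1?addnC.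
  case: n => [|n] in dn le_nkN le_kn.
    have [P [_ sP eP]] := dn; move: sP.
    rewrite leqn0 size_poly_eq0 => /eqP P0; move: eP; rewrite P0 horner0.
    by apply/eqP; rewrite invr_eq0.
  apply: (IH n k z) => //; have [P [hP sP eP]] := dn; have [Q [hQ sQ eQ]] := dk.
  have k_gt0 : (0 < k)%N.
    rewrite lt0n; apply: contra_neqN (invr_neq0 u0) => /eqP k0.
    by move: sQ; rewrite k0 leqn0 size_poly_eq0 eQ => /eqP ->; rewrite horner0.
  have BW : B (1 - u * Q`_0)^-1 by exact: unit1.
  set w := (1 - _)^-1 in BW.
  have w0 : 1 - u * Q`_0 != 0.
    rewrite subr_eq0; apply/eqP => h; apply: nBu.
    by have := hQ 0%N; rewrite -(mulKf u0 Q`_0) -h mulr1.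
  (* The relation for [z^-1] rewrites [z ^+ n] in terms of lower powers of [z]. *)
  have e1 : z ^+ n = \sum_(j < k.-1) u * w * Q`_j.+1 * z ^+ (n - j.+1).
    have eQ1 : u^-1 - Q`_0 = \sum_(j < k.-1) Q`_j.+1 * z^-1 ^+ j.+1.
      have sQ' : (size Q <= k.-1.+1)%N by rewrite prednK.
      rewrite eQ (horner_coef_wide _ sQ').
      by rewrite big_ord_recl expr0 mulr1 addrC addKr.
    transitivity (u * w * (u^-1 - Q`_0) * z ^+ n).
      by rewrite -[LHS]mul1r; congr (_ * _); rewrite mulrAC mulrBr !divff.
    rewrite eQ1 big_distrr big_distrl; apply: eq_bigr => j _ /=.
    rewrite -!mulrA; congr (_ * (_ * (_ * _))).
    have le_jn : (j.+1 <= n)%N by have := ltn_ord j; lia.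
    rewrite -{1}(subnK le_jn) exprD.
    by rewrite mulrC exprVn mulfK // expf_neq0.
  exists (\poly_(i < n) P`_i + \sum_(j < k.-1) (P`_n * (u * w * Q`_j.+1)) *: 'X^(n - j.+1)).
  split.
  - move=> i; rewrite coefD coef_poly coef_sum; apply: (BD); first by case: ifP.
    apply: big_ind => // j _; rewrite coefZ coefXn; apply: (BM).
      by do 3!apply: (BM) => //.
    by case: eqP.
  - apply: (leq_trans (size_polyD _ _)); rewrite geq_max size_poly /=.
    apply: (leq_trans (size_sum _ _ _)); apply/bigmax_leqP => j _.
    apply: (leq_trans (size_scale_leq _ _)); rewrite size_polyXn.
    by have := ltn_ord j; lia.
  - rewrite hornerD horner_poly horner_sum eP (horner_coef_wide _ sP) big_ord_recr /=.
    congr (_ + _); rewrite e1 big_distrr; apply: eq_bigr => j _ /=.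
    by rewrite hornerZ hornerXn !mulrA.
exists B; split=> //; split=> //; split=> //; split=> //; split=> //; split; last split.
- by move=> c; apply/AsB/Aiota.
- by exists u^-1.
move=> z z0; apply: contrapT => /not_orP[nz niz].
have [P [hP eP]] := adjoin _ nz; have [Q [hQ eQ]] := adjoin _ niz.
by apply: (@degP _ (size P) (size Q) z) => //; [exists P|exists Q].
Qed.
End Chevalley.

(** * The rational subfield *)

Section RationalSubfield.
Variables (K F : fieldType) (ev : {rmorphism {poly K} -> F}).

Definition consts : {rmorphism K -> F} := ev \o polyC.

Lemma ev_horner P : (map_poly consts P).[ev 'X] = ev P.
Proof.
elim/poly_ind: P => [|P c IH]; first by rewrite !rmorph0 horner0.
by rewrite !rmorphD !rmorphM /= map_polyX map_polyC hornerMXaddC IH.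
Qed.

Definition rational (z : F) := exists P Q, ev Q != 0 /\ z = ev P / ev Q.

Lemma rational_ev P : rational (ev P).
Proof. by exists P, 1; rewrite rmorph1 divr1 oner_eq0. Qed.

Lemma rationalB z w : rational z -> rational w -> rational (z - w).
Proof.
move=> [P [Q [Q0 ->]]] [R [S [S0 ->]]]; exists (P * S - R * Q), (Q * S).
rewrite !(rmorphB, rmorphM) mulf_neq0 //; split=> //.
by field; rewrite Q0 S0.
Qed.
Lemma rationalM z w : rational z -> rational w -> rational (z * w).
Proof.
move=> [P [Q [Q0 ->]]] [R [S [S0 ->]]]; exists (P * R), (Q * S).
by rewrite !rmorphM mulf_neq0 // mulf_div.
Qed.
Lemma rationalD z w : rational z -> rational w -> rational (z + w).
Proof.
move=> rz rw; rewrite -[w]opprK; apply: rationalB => //.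
by rewrite -sub0r; apply: rationalB => //; rewrite -(rmorph0 ev); exact: rational_ev.
Qed.

Lemma valring_ev O P : valring consts O -> O (ev 'X) -> O (ev P).
Proof.
move=> hO Ox; rewrite -ev_horner horner_coef; apply: (valring_sum hO) => i _.
apply: (valringM hO); last exact: (valringX hO).
by rewrite coef_map; exact: (valring_const hO).
Qed.

Hypothesis ev_inj : injective ev.

Let ev_eq0 P : (ev P == 0) = (P == 0).
Proof. by rewrite -(rmorph0 ev) (inj_eq ev_inj). Qed.

(** Chevalley's theorem for the ring [K[x]] and [u = Q(x)]: a nonconstant [Q] has no polynomial
    inverse. *)
Lemma exists_valring_above (Q : {poly K}) : (1 < size Q)%N ->
  exists O, [/\ valring consts O, O (ev 'X) & maxideal O (ev Q)].
Proof.
move=> sQ; have Q0 : Q != 0 by rewrite -size_poly_gt0 ltnW.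
case: (@exists_valring K F consts (fun z => exists P, z = ev P) (ev Q)).
- by move=> c; exists c%:P.
- by move=> _ _ [P ->] [R ->]; exists (P - R); rewrite rmorphB.
- by move=> _ _ [P ->] [R ->]; exists (P * R); rewrite rmorphM.
- by exists Q.
- case=> P eP; have /ev_inj/(congr1 (fun R : {poly K} => size R)) : ev (P * Q) = ev 1.
    by rewrite rmorphM -eP mulVf ?rmorph1 // ev_eq0.
  have P0 : P != 0 by rewrite -ev_eq0 -eP invr_eq0 ev_eq0.
  rewrite size_mul // size_poly1; rewrite -size_poly_gt0 in P0.
  by case: (size P) (size Q) P0 sQ => [|n] [|[|k]] //; lia.
move=> O [hO AO nO]; exists O; split=> //; first by apply: AO; exists 'X.
by split; [apply: AO; exists Q|case].
Qed.

(** Chevalley's theorem for [K[1/x]] and [u = 1/x]. Were [x] a polynomial [P] in [1/x], multiplying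
    by [x^d] with [d = size P] would equate [X^(d+1)] with a polynomial of degree at most [d]. *)
Lemma exists_valring_infty : exists O, valring consts O /\ ~ O (ev 'X).
Proof.
have x0 : ev 'X != 0 by rewrite ev_eq0 polyX_eq0.
pose A z := exists P : {poly K}, z = (map_poly consts P).[(ev 'X)^-1].
case: (@exists_valring K F consts A (ev 'X)^-1); last 1 first.
- by move=> O [hO _]; rewrite invrK; exists O.
- by move=> c; exists c%:P; rewrite map_polyC hornerC.
- by move=> _ _ [P ->] [R ->]; exists (P - R); rewrite rmorphB hornerD hornerN.
- by move=> _ _ [P ->] [R ->]; exists (P * R); rewrite rmorphM hornerM.
- by exists 'X; rewrite map_polyX hornerX.
rewrite invrK => -[P eP].
have /ev_inj/(congr1 (fun R : {poly K} => R`_(size P).+1)) :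
    ev ('X^((size P).+1)) = ev (\sum_(i < size P) P`_i *: 'X^(size P - i)).
  rewrite rmorphXn exprS {1}eP horner_coef big_distrl raddf_sum /=.
  rewrite size_map_poly; apply: eq_bigr => i _.
  rewrite coef_map -mul_polyC rmorphM rmorphXn /= -mulrA exprVn; congr (_ * _).
  by rewrite mulrC -expfB_cond // (negPf x0) add0n ltnW.
rewrite coefXn eqxx coef_sum big1 => [/eqP|i _]; first by rewrite oner_eq0.
by rewrite coefZ coefXn gtn_eqF ?mulr0 // ltnS leq_subr.
Qed.

(** A nonconstant reduced denominator would vanish at some place; as [z] is regular there, the
    numerator would vanish too, against Bezout. *)
Lemma rational_integral z : rational z ->
  (forall O, valring consts O -> O (ev 'X) -> O z) -> exists P, z = ev P.
Proof.
move=> [P [Q [Q0 ez]]] intz; rewrite ev_eq0 in Q0.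
pose g := gcdp P Q; have g0 : g != 0 by rewrite gcdp_eq0 negb_and Q0 orbT.
have eP : P = P %/ g * g by rewrite divpK // dvdp_gcdl.
have eQ : Q = Q %/ g * g by rewrite divpK // dvdp_gcdr.
have cop : coprimep (P %/ g) (Q %/ g) by apply: coprimep_div_gcd; rewrite Q0 orbT.
set P' := P %/ g in eP cop; set Q' := Q %/ g in eQ cop.
have Q'0 : Q' != 0 by apply: contraNneq Q0 => Q'0; rewrite eQ Q'0 mul0r.
have {}ez : z * ev Q' = ev P'.
  rewrite ez eP eQ !rmorphM invfM mulrACA divff ?ev_eq0 // mulr1 divfK //.
  by rewrite ev_eq0.
have [sQ|sQ] := leqP (size Q') 1.
  exists ((Q'`_0)^-1 *: P'); rewrite -mul_polyC rmorphM -ez.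
  have -> : ev Q' = consts Q'`_0 by rewrite /= -size1_polyC.
  rewrite -[ev _%:P]/(consts _) fmorphV mulrCA mulVf ?mulr1 // fmorph_eq0.
  by apply: contraNneq Q'0 => h; rewrite (size1_polyC sQ) h polyC0.
have [O [hO Ox mQ]] := exists_valring_above sQ.
have mP : maxideal O (ev P') by rewrite -ez; apply: (maxidealM hO) => //; apply: intz.
have [[u v] /= e1] := Bezout_eq1_coprimepP _ _ cop.
case: (maxideal1 hO); rewrite -(rmorph1 ev) -e1 rmorphD !rmorphM.
by apply: (maxidealD hO); apply: (maxidealM hO) => //; exact: (valring_ev _ hO).
Qed.

(** The pole order at infinity, measured in powers of [x], is the degree. If the degree exceeded
    [r], then [P] and [P] minus its leading term, divided by the leading power of [x], would both
    lie in the maximal ideal, and hence so would the leading coefficient. *)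
Lemma valring_infty_size O P r : valring consts O -> ~ O (ev 'X) ->
  O (ev P / ev 'X ^+ r) <-> (size P <= r.+1)%N.
Proof.
move=> hO nOx; have mx := maxideal_inv hO nOx.
have x0 : ev 'X != 0 by rewrite ev_eq0 polyX_eq0.
have le_in (Q : {poly K}) n : (size Q <= n.+1)%N -> O (ev Q / ev 'X ^+ n).
  move=> sQ; rewrite -ev_horner (@horner_coef_wide _ n.+1) ?size_map_poly //.
  rewrite big_distrl /=; apply: (valring_sum hO) => i _; rewrite -mulrA.
  apply: (valringM hO); first by rewrite coef_map; exact: (valring_const hO).
  have -> : ev 'X ^+ i / ev 'X ^+ n = (ev 'X)^-1 ^+ (n - i).
    rewrite expfB_cond ?exprVn ?invrK 1?mulrC //.
    by rewrite invr_eq0 (negPf x0) add0n -ltnS.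
  by apply: (valringX hO); case: mx.
split; last exact: le_in.
move=> OP; rewrite leqNgt; apply/negP => ltr.
have P0 : P != 0 by rewrite -size_poly_gt0; exact: leq_trans ltr.
set d := (size P).-2; have sP : size P = d.+2 by rewrite /d; case: (size P) ltr => [|[]].
have lc0 : lead_coef P != 0 by rewrite lead_coef_eq0.
have mP : maxideal O (ev P / ev 'X ^+ d.+1).
  have -> : ev P / ev 'X ^+ d.+1 = ev P / ev 'X ^+ r * (ev 'X)^-1 ^+ (d.+1 - r).
    rewrite -mulrA; congr (_ * _); rewrite -!exprVn -exprD subnKC //; lia.
  by apply: (maxidealM hO) => //; apply: (maxidealX hO) => //; lia.
pose Q := P - (lead_coef P)%:P * 'X^(d.+1).
have sQ : (size Q <= d.+1)%N.
  apply/leq_sizeP => i; rewrite leq_eqVlt => /orP[/eqP <-|lti].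
    by rewrite coefB coefCM coefXn eqxx mulr1 lead_coefE sP subrr.
  by rewrite coefB coefCM coefXn gtn_eqF // mulr0 subr0 nth_default // sP.
have mQ : maxideal O (ev Q / ev 'X ^+ d.+1).
  have -> : ev Q / ev 'X ^+ d.+1 = ev Q / ev 'X ^+ d * (ev 'X)^-1.
    by rewrite -mulrA -invfM exprSr.
  by apply: (maxidealM hO) => //; exact: le_in.
have : maxideal O (consts (lead_coef P)).
  have -> : consts (lead_coef P) = ev P / ev 'X ^+ d.+1 - ev Q / ev 'X ^+ d.+1.
    rewrite -mulrBl -rmorphB /Q opprB addrC subrK rmorphM rmorphXn mulfK //.
    exact: expf_neq0.
  exact: (maxidealB hO).
case=> _; apply; rewrite fmorph_eq0 lc0; split=> //; rewrite -fmorphV.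
exact: (valring_const hO).
Qed.

(* the Riemann-Roch space of [a] times the pole divisor of [x] *)
Definition bounded a (z : F) := forall O, valring consts O ->
  (O (ev 'X) -> O z) /\ (~ O (ev 'X) -> O (z / ev 'X ^+ a)).

Lemma bounded_rational a z : rational z -> bounded a z ->
  exists2 P : {poly K}, (size P <= a.+1)%N & z = ev P.
Proof.
move=> rz bz; case: (rational_integral rz) => [O hO Ox|P eP].
  by apply: (bz O hO).1.
exists P => //; have [O [hO nOx]] := exists_valring_infty.
by apply/(valring_infty_size _ _ hO nOx); rewrite -eP; apply: (bz O hO).2.
Qed.

End RationalSubfield.

(** * Characteristic p *)

Lemma exprD_pchar (p : nat) (R : comNzRingType) (pR : p \in [pchar R]) (a b : R) :
  (a + b) ^+ p = a ^+ p + b ^+ p.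
Proof. by rewrite -!(pFrobenius_autE pR) rmorphD. Qed.

Lemma expr_sum_pchar (p : nat) (R : comNzRingType) (pR : p \in [pchar R]) k (G : 'I_k -> R) :
  (\sum_i G i) ^+ p = \sum_i G i ^+ p.
Proof. by rewrite -(pFrobenius_autE pR) rmorph_sum. Qed.

Lemma exprD_pow (p : nat) (R : comNzRingType) (pR : p \in [pchar R]) t (a b : R) :
  (a + b) ^+ (p ^ t) = a ^+ (p ^ t) + b ^+ (p ^ t).
Proof.
elim: t => [|t IH]; first by rewrite !expr1.
by rewrite expnSr !exprM IH exprD_pchar.
Qed.

Lemma exprB_pow (p : nat) (R : comNzRingType) (pR : p \in [pchar R]) t (a b : R) :
  (a - b) ^+ (p ^ t) = a ^+ (p ^ t) - b ^+ (p ^ t).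
Proof. by apply/eqP; rewrite eq_sym subr_eq -exprD_pow // subrK. Qed.

Lemma natr_expp (p : nat) (R : comNzRingType) (n : nat) : p \in [pchar R] -> n%:R ^+ p = n%:R :> R.
Proof. by move=> pR; rewrite -(pFrobenius_autE pR) rmorph_nat. Qed.

Lemma natr_inj_pchar (p : nat) (R : idomainType) i j : p \in [pchar R] -> (i < p)%N -> (j < p)%N ->
  i%:R = j%:R :> R -> i = j.
Proof.
move=> pR; wlog le_ij : i j / (i <= j)%N => [wl|ip jp /eqP].
  by have [/wl //|/ltnW/wl h ip jp /esym/(h jp ip)] := leqP i j.
rewrite eq_sym -subr_eq0 -natrB // -(dvdn_pcharf pR) => /dvdn_leq.
by case: (ltngtP i j) le_ij => // lt _; rewrite subn_gt0 => /(_ lt); lia.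
Qed.

(** * Independence of Artin-Schreier roots with bounded poles *)

Section ArtinSchreierIndependence.
Variables (K F : fieldType) (p : nat) (ev : {rmorphism {poly K} -> F}).
Hypotheses (pK : p \in [pchar K]) (ev_inj : injective ev).

Let p_gt1 : (1 < p)%N.
Proof. exact/prime_gt1/(pcharf_prime pK). Qed.

(* With [N = p ^ s + 1] this is [('X^N)^p - 'X^N - ('X^p - 'X)^N]: up to an
   Artin-Schreier coboundary it is a polynomial in [x^p - x], and yet its degree
   [p ^ s.+1 + 1] is prime to [p]. *)
Definition as_poly s : {poly K} :=
  'X^(p ^ s.+1 + 1) + 'X^(p ^ s + p) - 'X^(p ^ s + 1) *+ 2.

(** For [s > 0] the first monomial dominates; for [s = 0] the first two exponents would coincide. *)
Lemma size_as_poly s : (0 < s)%N -> size (as_poly s) = (p ^ s.+1).+2.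
Proof.
move=> s_gt0; have ps : (1 < p ^ s)%N by rewrite -{1}(expn0 p) ltn_exp2l.
have le1 : (p ^ s + p < p ^ s.+1 + 1)%N by rewrite expnS; nia.
transitivity (p ^ s.+1 + 1).+1; last by rewrite addn1.
rewrite /as_poly -addrA size_polyDl size_polyXn //.
apply: (leq_ltn_trans (size_polyD _ _)); rewrite gtn_max size_polyXn size_polyN.
rewrite ltnS le1 /=; apply: (@leq_ltn_trans (p ^ s + 1).+1).
  by apply/leq_sizeP => i lti; rewrite coefMn coefXn gtn_eqF // mul0rn.
by lia.
Qed.

Lemma pchar_field : p \in [pchar F].
Proof. by apply: (rmorph_pchar (consts ev)). Qed.

Variables (a c : nat).
Hypotheses (c_gt0 : (0 < c)%N) (pa_lt : (p * a < p ^ c)%N).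

Lemma size_expp (P : {poly K}) : P != 0 -> size (P ^+ p) = ((size P).-1 * p).+1.
Proof.
move=> P0; rewrite -[LHS]prednK; first by rewrite size_exp.
by rewrite size_poly_gt0 expf_neq0.
Qed.

(* The degree of the sum is prime to [p], that of a [p]-th power is not. *)
Lemma size_as_comb k (cf : nat -> {poly K}) (E : {poly K}) :
  (forall j, size (cf j) <= a.+1)%N -> cf k != 0 ->
  ((p ^ (c + k).+1).+2 <=
     size (\sum_(j < k.+1) cf j ^+ p * as_poly (c + j) + E ^+ p)%R)%N.
Proof.
move=> scf cfk.
have cj_gt0 j : (0 < c + j)%N by rewrite addn_gt0 c_gt0.
have f0 j : as_poly (c + j) != 0 by rewrite -size_poly_gt0 size_as_poly.
have st j : cf j != 0 -> size (cf j ^+ p * as_poly (c + j)) =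
     ((size (cf j)).-1 * p + (p ^ (c + j).+1).+2)%N.
  by move=> cj0; rewrite size_mul ?expf_neq0 // size_expp // size_as_poly.
set S := \sum_(j < _) _.
(* The last summand dominates: for [j < k] the degree is at most [p a + p^(c+k) + 1], and
   [p a < p^c] keeps this below [p^(c+k+1) + 1]. *)
have sS : size S = ((size (cf k)).-1 * p + (p ^ (c + k).+1).+2)%N.
  rewrite /S big_ord_recr /= addrC size_polyDl ?st //.
  apply: (leq_ltn_trans (size_sum _ _ _)); apply: (@leq_ltn_trans (p ^ (c + k).+1).+1);
    last by rewrite !addnS !ltnS leq_addl.
  apply/bigmax_leqP => j _; have [->|cj0] := eqVneq (cf j) 0.
    by rewrite expr0n gtn_eqF ?mul0r ?size_poly0 // ltnW.
  rewrite st //; have := scf j; have ltjk := ltn_ord j.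
  have : (p ^ (c + j).+1 <= p ^ (c + k))%N by rewrite leq_exp2l //; lia.
  have : (p ^ c <= p ^ (c + k))%N by rewrite leq_exp2l //; lia.
  have := leq_mul p_gt1 (leqnn (p ^ (c + k))); rewrite [(p ^ (c + k).+1)%N]expnS.
  have : ((size (cf j)).-1 * p <= p * a)%N.
    by rewrite mulnC leq_mul2l; apply/orP; right; have := scf j; lia.
  by nia.
have sSge : ((p ^ (c + k).+1).+2 <= size S)%N by rewrite sS leq_addl.
have [->|E0] := eqVneq E 0; first by rewrite expr0n gtn_eqF ?addr0 // ltnW.
have sE := size_expp E0.
have [lt|lt|eq] := ltngtP (size (E ^+ p)) (size S).
- by rewrite size_polyDl.
- by rewrite addrC size_polyDl //; exact: leq_trans sSge (ltnW lt).
move: eq; rewrite sE sS addnS => -[]/(congr1 (modn^~ p)).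
by rewrite modnMl addnS expnS -addn1 [(p * _)%N]mulnC -mulnDl modnMDl modn_small.
Qed.

(** Induction removes the last coefficient. If it were nonzero, [w^p - sum cf_j^p y_j] would be a
    polynomial whose degree is at least [p^(c+k+1) + 1] by [size_as_comb], but whose pole at
    infinity is too small for that. *)
Lemma bounded_as_independent k (y : nat -> F) (cf : nat -> {poly K}) e :
  (forall j, (j < k)%N -> y j ^+ p - y j = ev (as_poly (c + j))) ->
  (forall j, size (cf j) <= a.+1)%N -> rational ev e ->
  bounded ev a (\sum_(j < k) ev (cf j) * y j + e) ->
  forall j, (j < k)%N -> cf j = 0.
Proof.
move=> hy scf re; elim: k hy => // k IH hy bw.
have hy' j : (j < k)%N -> y j ^+ p - y j = ev (as_poly (c + j)).
  by move=> ltj; apply: hy; exact: ltnW.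
suff cfk : cf k = 0.
  move=> j; rewrite ltnS leq_eqVlt => /orP[/eqP -> //|]; apply: IH => //.
  by move: bw; rewrite big_ord_recr /= cfk rmorph0 mul0r addr0.
apply/eqP; apply: contraT => cfk; set w := \sum_(j < _) _ + e in bw.
have x0 : ev 'X != 0 by rewrite -(rmorph0 ev) (inj_eq ev_inj) polyX_eq0.
have Oy O (j : 'I_k.+1) : valring (consts ev) O -> O (ev 'X) -> O (y j).
  move=> hO Ox; apply: (valring_AS hO p_gt1 (valring1 hO)).
  by rewrite mul1r hy //; exact: valring_ev.
(* Both [w] and the [y j] are regular wherever [x] is, so the rational part [e] is a polynomial. *)
have [E eE] : exists E, e = ev E.
  apply: (rational_integral ev_inj re) => O hO Ox.
  have -> : e = w - \sum_(j < k.+1) ev (cf j) * y j by rewrite /w addrC addKr.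
  apply: (valringB hO); first exact: (bw O hO).1.
  apply: (valring_sum hO) => j _; apply: (valringM hO); last exact: Oy.
  exact: valring_ev.
set D := \sum_(j < k.+1) cf j ^+ p * as_poly (c + j) + E ^+ p.
have eD : ev D = w ^+ p - \sum_(j < k.+1) ev (cf j ^+ p) * y j.
  rewrite /w (exprD_pchar pchar_field) (expr_sum_pchar pchar_field) rmorphD rmorphXn.
  rewrite -eE addrAC rmorph_sum /= -sumrB; congr (_ + _); apply: eq_bigr => j _.
  by rewrite rmorphM rmorphXn -hy // exprMn mulrBr.
have [O [hO nOx]] := exists_valring_infty ev_inj.
(* An upper bound for the pole order: [w^p] contributes at most [p a], and [cf_j^p y_j] at most
   [p a + p^(c+j) + 1]. *)
pose r := (p * a + (p ^ (c + k)).+1)%N.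
have Ox : O (ev 'X)^-1 by exact: (valring_inv hO).
have shift z n l : (n <= l)%N -> O (z / ev 'X ^+ n) -> O (z / ev 'X ^+ l).
  move=> lenl Oz; rewrite -(subnKC lenl) exprD invfM mulrA; apply: (valringM hO) => //.
  by rewrite -exprVn; apply: (valringX hO).
(* The exponent rounds up [deg f_j / p]. The rescaled root satisfies an Artin-Schreier equation with
   coefficient a power of [1/x] and regular right-hand side. *)
have Oyinf (j : 'I_k.+1) : O (y j / ev 'X ^+ (p ^ (c + j)).+1).
  set n := (p ^ _).+1.
  apply: (valring_AS hO p_gt1 (g := (ev 'X)^-1 ^+ (n * p.-1))).
    exact: (valringX hO).
  have -> : (y j / ev 'X ^+ n) ^+ p - (ev 'X)^-1 ^+ (n * p.-1) * (y j / ev 'X ^+ n)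
     = ev (as_poly (c + j)) / ev 'X ^+ (n * p).
    rewrite -hy // exprMn !exprVn -exprM mulrBl mulrCA -invfM -exprD.
    by congr (_ - _ * (_ ^+ _)^-1); rewrite addnC -mulnS prednK // ltnW.
  apply/(valring_infty_size ev_inj _ _ hO nOx); rewrite size_as_poly ?addn_gt0 ?c_gt0 //.
  by rewrite /n expnS ltnS mulSn mulnC; lia.
have : O (ev D / ev 'X ^+ r).
  rewrite eD mulrBl; apply: (valringB hO).
    apply: (@shift _ (p * a)%N); first by rewrite leq_addr.
    rewrite mulnC exprM -expr_div_n; apply: (valringX hO); exact: (bw O hO).2.
  rewrite big_distrl; apply: (valring_sum hO) => j _ /=.
  apply: (@shift _ (p * a + (p ^ (c + j)).+1)%N).
    by rewrite leq_add2l ltnS leq_exp2l // leq_add2l -ltnS.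
  rewrite exprD invfM mulrACA; apply: (valringM hO) => //.
  apply/(valring_infty_size ev_inj _ _ hO nOx).
  have [->|c0] := eqVneq (cf j) 0.
    by rewrite expr0n gtn_eqF ?size_poly0 // ltnW.
  by rewrite size_expp // ltnS mulnC leq_mul2l; have := scf j; lia.
move/(valring_infty_size ev_inj _ _ hO nOx).
have := size_as_comb E scf cfk; rewrite -/D /r => h1 h2.
have := leq_trans h1 h2; rewrite expnS !ltnS addnS ltnS.
have : (p ^ c <= p ^ (c + k))%N by rewrite leq_exp2l // leq_addr.
have := leq_mul p_gt1 (leqnn (p ^ (c + k))); lia.
Qed.

End ArtinSchreierIndependence.

(** * Elementary abelian Artin-Schreier extensions *)

Inductive subring_gen (F : fieldType) (B : F -> Prop) : F -> Prop :=
| gen_base z : B z -> subring_gen B z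
| gen_add z w : subring_gen B z -> subring_gen B w -> subring_gen B (z + w)
| gen_mul z w : subring_gen B z -> subring_gen B w -> subring_gen B (z * w).

(** The vectors that index the generators [y_j |-> y_j + 1] of the Galois group. *)
Definition unit_vec (j l : nat) : nat := (l == j)%N.

(* [lfield] is [K(x, y_0, ..., y_(k-1))] with [K[x]] embedded by [lev] and [y_j = ly j]
   for [j < k] (the other values of [ly] are junk); [ls c] is the automorphism
   [y_j |-> y_j + c j] over [K(x)]. *)
Record level (K : fieldType) (p : nat) (f : nat -> {poly K}) (k : nat) := Level {
  lfield :> fieldType;
  lev : {rmorphism {poly K} -> lfield};
  ly : nat -> lfield;
  ls : (nat -> nat) -> {rmorphism lfield -> lfield};
  lev_inj : injective lev;
  ly_eq : forall j, (j < k)%N -> ly j ^+ p - ly j = lev (f j);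
  ls_ev : forall c P, ls c (lev P) = lev P;
  ls_y : forall c j, (j < k)%N -> ls c (ly j) = ly j + (c j)%:R;
  l_gen : forall z,
    subring_gen (fun u => rational lev u \/ exists2 j, (j < k)%N & u = ly j) z;
  l_fix : forall z, (forall j, (j < k)%N -> ls (unit_vec j) z = z) -> rational lev z;
  l_fin : exists (T : finType) (b : T -> lfield), forall z,
    exists r : T -> lfield, (forall t, rational lev (r t)) /\ z = \sum_t r t * b t
}.

Section LevelTheory.
Variables (K : fieldType) (p : nat) (f : nat -> {poly K}) (k : nat) (L : level p f k).
Local Notation ev := (lev L).
Local Notation y := (ly L).
Local Notation iota := (consts ev).

Lemma ls_rational c z : rational ev z -> ls L c z = z.
Proof. by move=> [P [Q [Q0 ->]]]; rewrite fmorph_div !ls_ev. Qed.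

Lemma rational_natr n : rational ev n%:R.
Proof. by rewrite -(rmorph_nat ev); exact: rational_ev. Qed.

(** Surjectivity makes the pullback of a valuation ring a proper subring. *)
Lemma ls_surj c z : exists w, ls L c w = z.
Proof.
elim: (l_gen z) => {z} [z [rz|[j ltj ->]]|z w _ [z' <-] _ [w' <-]|z w _ [z' <-] _ [w' <-]].
- by exists z; exact: ls_rational.
- by exists (y j - (c j)%:R); rewrite rmorphB ls_y // rmorph_nat addrK.
- by exists (z' + w'); rewrite rmorphD.
- by exists (z' * w'); rewrite rmorphM.
Qed.

Lemma valring_ls O c : valring iota O -> valring iota (fun z => O (ls L c z)).
Proof.
move=> hO; split; first by rewrite rmorph0; exact: (valring0 hO).
split; first by rewrite rmorph1; exact: (valring1 hO).
split; first by move=> a b Oa Ob; rewrite rmorphB; exact: (valringB hO).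
split; first by move=> a b Oa Ob; rewrite rmorphM; exact: (valringM hO).
split; first by move=> a; rewrite ls_ev; exact: (valring_const hO).
split.
  case: hO => _ [_ [_ [_ [_ [[z nOz] _]]]]]; have [w ew] := ls_surj c z.
  by exists w; rewrite ew.
move=> z z0; rewrite fmorphV; apply: contrapT => /not_orP[h1].
by apply; exact: (valring_inv hO).
Qed.

Lemma maxideal_ls O c z : maxideal (fun z => O (ls L c z)) z <-> maxideal O (ls L c z).
Proof. by rewrite /maxideal fmorphV fmorph_eq0. Qed.

Lemma bounded_ls a c z : bounded ev a z -> bounded ev a (ls L c z).
Proof.
move=> bz O hO; have [] := bz _ (valring_ls c hO).
by rewrite fmorph_div rmorphXn !ls_ev.
Qed.

Lemma boundedB a z w : bounded ev a z -> bounded ev a w -> bounded ev a (z - w).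
Proof.
move=> bz bw O hO; have [z1 z2] := bz _ hO; have [w1 w2] := bw _ hO.
split=> h; first by apply: (valringB hO); [apply: z1|apply: w1].
by rewrite mulrBl; apply: (valringB hO); [apply: z2|apply: w2].
Qed.

Definition ldiff j z := ls L (unit_vec j) z - z.

(* elements killed by any [d.+1] successive operators [ls L (unit_vec j) - 1] *)
Fixpoint lfilt d z := if d is d'.+1 then
  forall j, (j < k)%N -> lfilt d' (ldiff j z) else rational ev z.

Lemma ldiff_rational j z : rational ev z -> ldiff j z = 0.
Proof. by move=> rz; rewrite /ldiff ls_rational // subrr. Qed.

Lemma lfilt_rational d z : rational ev z -> lfilt d z.
Proof.
elim: d z => // d IH z rz j _; rewrite ldiff_rational //; apply: IH.
exact: (rational_natr 0).
Qed.

Lemma lfiltS d z : lfilt d z -> lfilt d.+1 z.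
Proof.
elim: d z => [|d IH] z; first exact: lfilt_rational.
by move=> h j ltj; apply: IH; apply: h.
Qed.

Lemma lfilt_le d e z : (d <= e)%N -> lfilt d z -> lfilt e z.
Proof. by move=> /subnK <-; elim: (e - d)%N => // n IH /IH /lfiltS. Qed.

Lemma lfiltD d z w : lfilt d z -> lfilt d w -> lfilt d (z + w).
Proof.
elim: d z w => [|d IH] z w; first exact: rationalD.
move=> hz hw j ltj.
have -> : ldiff j (z + w) = ldiff j z + ldiff j w by rewrite /ldiff rmorphD; ring.
by apply: IH; [apply: hz|apply: hw].
Qed.

(** The twisted Leibniz rule [D(z w) = D(z) w + D(z) D(w) + z D(w)] for [D = ldiff j]. *)
Lemma lfiltM n d e z w : (d + e <= n)%N -> lfilt d z -> lfilt e w -> lfilt n (z * w).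
Proof.
elim: n d e z w => [|n IH] d e z w.
  by rewrite leqn0 addn_eq0 => /andP[/eqP -> /eqP ->]; exact: rationalM.
move=> le_den hz hw j ltj.
have -> : ldiff j (z * w) = ldiff j z * w + (ldiff j z * ldiff j w + z * ldiff j w).
  by rewrite /ldiff rmorphM; ring.
case: d => [|d] in le_den hz *.
  rewrite ldiff_rational // !mul0r !add0r.
  case: e => [|e] in le_den hw *; last by apply: (IH 0%N e) => //; apply: hw.
  by rewrite ldiff_rational // mulr0; apply: lfilt_rational; exact: (rational_natr 0).
case: e => [|e] in le_den hw *.
  rewrite (ldiff_rational _ hw) !mulr0 !addr0.
  by apply: (IH d 0%N) => //; apply: hz.
apply: lfiltD; first by apply: (IH d e.+1) => //; apply: hz.
apply: lfiltD; last by apply: (IH d.+1 e) => //; [lia|apply: hw].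
by apply: (IH d e); [lia|apply: hz|apply: hw].
Qed.

(** The Galois action is unipotent: each [y_j] has depth 1, and depths are bounded on sums and
    products. *)
Lemma lfilt_exhaustive z : exists d, lfilt d z.
Proof.
elim: (l_gen z) => {z} [z [rz|[j ltj ->]]|z w _ [d hz] _ [e hw]|z w _ [d hz] _ [e hw]].
- by exists 0%N.
- exists 1%N => l ltl; rewrite /ldiff ls_y // addrC addKr; exact: rational_natr.
- exists (d + e)%N; apply: lfiltD; first exact: lfilt_le (leq_addr _ _) hz.
  exact: lfilt_le (leq_addl _ _) hw.
- by exists (d + e)%N; exact: (lfiltM (leqnn _)).
Qed.

(** Since [ldiff l] sends [y_j] to 1 if [j = l] and to 0 otherwise, subtracting the combination
    leaves an element fixed by all generators. *)
Lemma rational_sub_comb (r : nat -> L) z :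
  (forall j, (j < k)%N -> rational ev (r j)) ->
  (forall j, (j < k)%N -> ldiff j z = r j) ->
  rational ev (z - \sum_(j < k) r j * y j).
Proof.
move=> rr dz; apply: l_fix => l ltl; rewrite rmorphB rmorph_sum.
have -> : ls L (unit_vec l) z = r l + z by rewrite -dz // subrK.
have -> : \sum_(j < k) ls L (unit_vec l) (r j * y j) = \sum_(j < k) r j * y j + r l.
  rewrite (eq_bigr (fun j : 'I_k => r j * y j + (j == Ordinal ltl)%:R * r j)).
    rewrite big_split /=; congr (_ + _); rewrite (bigD1 (Ordinal ltl)) //= eqxx mul1r.
    by rewrite big1 ?addr0 // => j /negPf ->; rewrite mul0r.
  move=> j _; rewrite rmorphM (ls_rational _ (rr _ (ltn_ord j))) ls_y // mulrDr.
  by rewrite [X in _ + X]mulrC.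
by ring.
Qed.

End LevelTheory.

(** * Elements of a level with bounded poles at infinity *)

Section BoundedElements.
Variables (K : fieldType) (p a c k : nat) (L : level p (fun j => as_poly K p (c + j)) k).
Local Notation ev := (lev L).
Local Notation iota := (consts ev).
Hypotheses (pK : p \in [pchar K]) (c_gt0 : (0 < c)%N) (pa_lt : (p * a < p ^ c)%N).

(** The differences [ldiff j z] are again bounded and of smaller depth, hence by induction
    polynomials of degree at most [a]. So [z] is a combination of the [y_j] plus a rational part,
    and independence makes all differences vanish. *)
Lemma bounded_lfilt d z : bounded ev a z -> lfilt d z -> rational ev z.
Proof.
elim: d z => // d IH z bz hz.
have bd j : bounded ev a (ldiff j z) by apply: boundedB => //; exact: bounded_ls.
have /choice [cf hcf] : forall j, exists P : {poly K},
    (size P <= a.+1)%N /\ ((j < k)%N -> ldiff j z = ev P).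
  move=> j; have [ltj|_] := boolP (j < k)%N; last first.
    by exists 0; rewrite size_poly0.
  have [P sP eP] := bounded_rational (@lev_inj _ _ _ _ L) (IH _ (bd j) (hz j ltj)) (bd j).
  by exists P.
have scf j := (hcf j).1; have ecf j := (hcf j).2.
have re : rational ev (z - \sum_(j < k) ev (cf j) * ly L j).
  by apply: (@rational_sub_comb _ _ _ _ L (fun j => ev (cf j))) => // j _; exact: rational_ev.
have cf0 : forall j, (j < k)%N -> cf j = 0.
  apply: (bounded_as_independent pK (@lev_inj _ _ _ _ L) c_gt0 pa_lt (@ly_eq _ _ _ _ L) scf re).
  by rewrite addrC subrK.
apply: l_fix => j ltj; apply/eqP; rewrite -subr_eq0; apply/eqP.
by have := ecf j ltj; rewrite cf0 // rmorph0.
Qed.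

Lemma bounded_poly z : bounded ev a z -> exists2 P : {poly K}, (size P <= a.+1)%N & z = ev P.
Proof.
move=> bz; apply: bounded_rational (bz); first exact: lev_inj.
have [d hd] := lfilt_exhaustive z; exact: bounded_lfilt bz hd.
Qed.

(** An element algebraic over [K] is regular at every place, so it is a polynomial [P] in [x]; a
    nonzero [g] with [g(P) = 0] forces [P] to be constant. *)
Lemma level_const_closed : const_closed iota.
Proof.
move=> z [g [g0 gz]]; case: (@bounded_poly z) => [O hO|P _ eP].
  have Oz := valring_algebraic hO g0 gz; split=> // nOx.
  by apply: (valringM hO) => //; rewrite -exprVn; apply/(valringX hO)/(valring_inv hO).
have : ev (g \Po P) = 0.
  rewrite -(rootP gz) eP comp_polyE horner_coef size_map_poly rmorph_sum.
  apply: eq_bigr => i _; rewrite -mul_polyC rmorphM rmorphXn coef_map.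
  by [].
rewrite -(rmorph0 ev) => /(@lev_inj _ _ _ _ L)/eqP.
have [sP _|sP] := leqP (size P) 1; first by exists P`_0; rewrite eP {1}(size1_polyC sP).
by rewrite comp_poly_eq0 // (negPf g0).
Qed.

Lemma level_function_field : function_field iota.
Proof.
exists (ev 'X); split.
  by move=> P; rewrite ev_horner -(rmorph0 ev) => /(@lev_inj _ _ _ _ L).
have [T [b hb]] := l_fin L; exists #|T|, (fun i => b (enum_val i)) => z.
have [r [rr ->]] := hb z.
have /choice [PQ hPQ] : forall t, exists PQ : {poly K} * {poly K},
    PQ.2 != 0 /\ r t = ev PQ.1 / ev PQ.2.
  move=> t; have [P [Q [Q0 ->]]] := rr t; exists (P, Q); split=> //=.
  by apply: contraNneq Q0 => ->; rewrite rmorph0.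
exists (fun i => (PQ (enum_val i)).1), (fun i => (PQ (enum_val i)).2); split.
  by move=> i; case: (hPQ (enum_val i)).
rewrite (reindex (@enum_val T predT)) /=; last first.
  by apply: onW_bij; exact: enum_val_bij.
by apply: eq_bigr => i _; rewrite !ev_horner; case: (hPQ (enum_val i)) => _ ->.
Qed.
End BoundedElements.

(** * Places above a completely split polynomial *)

Lemma in_qpoly_eq0 (F : fieldType) (h : {poly F}) (hI : monic_irreducible_poly h) P :
  (in_qpoly h P == 0) = (h %| P).
Proof. by rewrite -val_eqE /= (mk_monicE hI) Pdiv.Idomain.dvdpE. Qed.

Section ResidueField.
Variables (K : finFieldType) (Q : {poly K}).
Hypothesis hQ : monic_irreducible_poly Q.

Lemma dvdp_expf_card P : Q %| P ^+ (#|K| ^ (size Q).-1) - P.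
Proof.
rewrite -(in_qpoly_eq0 hQ) rmorphB rmorphXn -(card_qfpoly hQ).
by rewrite (expf_card (in_qpoly Q P : {poly %/ Q with hQ})) subrr.
Qed.

Variables (F : fieldType) (ev : {rmorphism {poly K} -> F}) (O : F -> Prop).
Hypotheses (hO : valring (consts ev) O) (Ox : O (ev 'X)) (mQ : maxideal O (ev Q)).

Lemma maxideal_ev P : maxideal O (ev P) <-> Q %| P.
Proof.
split=> [mP|/dvdpP [R ->]]; last first.
  by rewrite rmorphM; apply: (maxidealM hO) => //; exact: valring_ev.
apply: contraT; rewrite -(irreducible_poly_coprime _ hQ.1).
move=> /Bezout_eq1_coprimepP [[u v] /= e1].
case: (maxideal1 hO); rewrite -(rmorph1 ev) -e1 rmorphD !rmorphM.
by apply: (maxidealD hO); apply: (maxidealM hO) => //; exact: (valring_ev _ hO).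
Qed.

(* Modulo [Q], [X^(q^n) - X] is the product of the [X - R] over representatives
   [R] of the classes of [K[x]/Q]. *)
Lemma residue_poly z : O z -> maxideal O (z ^+ (#|K| ^ (size Q).-1) - z) ->
  exists P, maxideal O (z - ev P).
Proof.
move=> Oz mz; pose k := {poly %/ Q with hQ}.
pose rep (a : k) : {poly K} := (a : {poly %/ Q}).
pose B : {poly {poly K}} :=
  \prod_(a : k) ('X - (rep a)%:P) - ('X^(#|K| ^ (size Q).-1) - 'X).
have repK (a : k) : in_qpoly Q (rep a) = a.
  by apply: val_inj; apply: in_qpoly_small; exact: size_mk_monic.
have mB i : maxideal O (ev B`_i).
  apply/maxideal_ev; rewrite -(in_qpoly_eq0 hQ).
  pose h : {rmorphism {poly K} -> k} := in_qpoly Q.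
  have : map_poly h B = 0.
    rewrite !rmorphB rmorph_prod rmorphXn /= map_polyX -(card_qfpoly hQ) finField_genPoly.
    apply/eqP; rewrite subr_eq0; apply/eqP; apply: eq_bigr => a _.
    by rewrite rmorphB /= map_polyX map_polyC /= repK.
  by move=> /polyP/(_ i); rewrite coef_map coef0 => /= ->.
have: maxideal O (\prod_(a : k) (z - ev (rep a))).
  have -> : \prod_(a : k) (z - ev (rep a)) =
      (map_poly ev B).[z] + (z ^+ (#|K| ^ (size Q).-1) - z).
    have -> : z ^+ (#|K| ^ (size Q).-1) - z = (map_poly ev ('X^(#|K| ^ (size Q).-1) - 'X)).[z].
      by rewrite rmorphB rmorphXn /= map_polyX hornerD hornerN hornerXn hornerX.
    rewrite -hornerD -rmorphD subrK rmorph_prod horner_prod; apply: eq_bigr => a _.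
    by rewrite rmorphB /= map_polyX map_polyC hornerXsubC.
  apply: (maxidealD hO) => //; rewrite horner_coef; apply: (maxideal_sum hO) => i _.
  by rewrite coef_map mulrC; apply: (maxidealM hO); [exact: (valringX hO)|exact: mB].
case/(maxideal_prime_prod hO) => [a|a ma]; last by exists (rep a).
by apply: (valringB hO) => //; exact: valring_ev.
Qed.

End ResidueField.

(** * Frobenius modulo [Q], residue fields and conjugate places *)

Section PlacesAbove.
Variables (K : finFieldType) (p e : nat) (f : nat -> {poly K}) (k : nat) (L : level p f k).
Variable (Q : {poly K}).
Hypotheses (pK : p \in [pchar K]) (cardK : #|K| = (p ^ e)%N).
Hypothesis hQ : monic_irreducible_poly Q.
Local Notation n := (size Q).-1.
Local Notation q := (#|K| ^ n)%N.
(* the trace of [f j] from [K[x]/Q] to the prime field vanishes *)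
Hypothesis trace0 : forall j, (j < k)%N -> Q %| \sum_(l < e * n) f j ^+ (p ^ l).
Local Notation ev := (lev L).
Local Notation y := (ly L).
Local Notation iota := (consts ev).

Let p_gt1 : (1 < p)%N. Proof. exact/prime_gt1/(pcharf_prime pK). Qed.
Let pF : p \in [pchar L]. Proof. exact: (pchar_field (lev L) pK). Qed.

(** Iterates [y^p = y + f]. At [t = e n] the added term is the trace, so [y j] is fixed modulo [Q]
    by the [q]-Frobenius. *)
Lemma as_root_pow j t : (j < k)%N ->
  y j ^+ (p ^ t) = y j + ev (\sum_(l < t) f j ^+ (p ^ l)).
Proof.
move=> ltj; elim: t => [|t IH]; first by rewrite expr1 big_ord0 rmorph0 addr0.
rewrite expnSr exprM IH exprD_pchar // -rmorphXn expr_sum_pchar; last first.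
  by rewrite pchar_poly.
rewrite big_ord_recl expr1 rmorphD -ly_eq // addrA [y j + _]addrC subrK.
congr (_ + ev _); apply: eq_bigr => l _.
by rewrite -exprM -expnSr.
Qed.

(** The ring [K[x, y_0, ..., y_(k-1)]], on whose generators Frobenius modulo [Q] is computed. *)
Definition integral_elt := subring_gen (fun u => (exists P, u = ev P) \/
  exists2 j, (j < k)%N & u = y j).

Lemma integral_ev P : integral_elt (ev P).
Proof. by apply: gen_base; left; exists P. Qed.

(** The [q]-th power map is a ring homomorphism, so generators suffice: polynomials in [x] are fixed
    modulo [Q] because [K[x]/Q] has [q] elements, the [y j] by the vanishing trace. *)
Lemma integral_q z : integral_elt z ->
  exists2 r, integral_elt r & z ^+ q - z = ev Q * r.
Proof.
elim=> {z} [_ [[P ->]|[j ltj ->]]|z w _ [r hr er] _ [s hs es]|z w hz [r hr er] hw [s hs es]].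
- have /dvdpP [R eR] := dvdp_expf_card hQ P.
  by exists (ev R); [exact: integral_ev|rewrite -rmorphXn -rmorphB eR rmorphM mulrC].
- have /dvdpP [R eR] := trace0 ltj.
  exists (ev R); first exact: integral_ev.
  by rewrite cardK -expnM as_root_pow // addrC addKr eR rmorphM mulrC.
- by exists (r + s); [exact: gen_add|rewrite cardK -expnM exprD_pow // expnM -cardK mulrDr -er -es; ring].
- exists (r * (w + ev Q * s) + z * s).
    by apply: gen_add; apply: gen_mul => //; apply: gen_add => //; apply: gen_mul => //; exact: integral_ev.
  have ez : z ^+ q = z + ev Q * r by rewrite -er addrC subrK.
  have ew : w ^+ q = w + ev Q * s by rewrite -es addrC subrK.
  by rewrite exprMn ez ew; ring.
Qed.

Lemma integral_denominator z : exists2 D : {poly K}, D != 0 & integral_elt (ev D * z).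
Proof.
elim: (l_gen z) => {z} [z [[P [Q' [Q0 ->]]]|[j ltj ->]]|z w _ [D D0 hD] _ [E E0 hE]|z w _ [D D0 hD] _ [E E0 hE]].
- exists Q'; last by rewrite mulrC divfK //; exact: integral_ev.
  by apply: contraNneq Q0 => ->; rewrite rmorph0.
- exists 1; first exact: oner_neq0.
  by rewrite rmorph1 mul1r; apply: gen_base; right; exists j.
- exists (D * E); first exact: mulf_neq0.
  have -> : ev (D * E) * (z + w) = ev E * (ev D * z) + ev D * (ev E * w).
    by rewrite rmorphM; ring.
  by apply: gen_add; apply: gen_mul => //; exact: integral_ev.
- exists (D * E); first exact: mulf_neq0.
  have -> : ev (D * E) * (z * w) = ev D * z * (ev E * w) by rewrite rmorphM; ring.
  exact: gen_mul.
Qed.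

Section OnePlace.
Variable O : L -> Prop.
Hypotheses (hO : valring iota O) (Ox : O (ev 'X)) (mQ : maxideal O (ev Q)).

Lemma integral_valring z : integral_elt z -> O z.
Proof.
elim=> {z} [_ [[P ->]|[j ltj ->]]|z w _ Oz _ Ow|z w _ Oz _ Ow].
- exact: valring_ev.
- apply: (valring_AS hO p_gt1 (valring1 hO)).
  by rewrite mul1r ly_eq //; exact: valring_ev.
- exact: (valringD hO).
- exact: (valringM hO).
Qed.

Lemma residue_integral z : integral_elt z -> exists P, maxideal O (z - ev P).
Proof.
move=> hz; apply: (residue_poly hQ hO Ox mQ) (integral_valring hz) _.
have [r hr ->] := integral_q hz; rewrite mulrC; apply: (maxidealM hO) => //.
exact: integral_valring.
Qed.

(* If [z] lies in the maximal ideal, [1 - z ^+ q.-1] is a unit multiplying [z]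
   into the ideal generated by [Q]: powers of [Q] cancel from denominators. *)
Lemma integral_fraction z : O z ->
  exists g, [/\ integral_elt g, ~ maxideal O g & integral_elt (g * z)].
Proof.
move=> Oz; have [D D0 hD] := integral_denominator z.
suff main d : forall (D : {poly K}) (g : L), (size D <= d)%N -> D != 0 -> integral_elt g ->
    ~ maxideal O g -> integral_elt (ev D * (g * z)) ->
    exists g, [/\ integral_elt g, ~ maxideal O g & integral_elt (g * z)].
  apply: (main (size D) D 1) => //; last by rewrite mul1r.
    by rewrite -(rmorph1 ev); exact: integral_ev.
  exact: maxideal1 hO.
elim: d => [|d IH] {D0 hD}D g sD D0 hg ng hDg.
  by case/negP: D0; rewrite -size_poly_leq0.
have [/dvdpP [D1 eD]|nQD] := boolP (Q %| D); last first.
  exists (ev D * g); split; last by rewrite -mulrA.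
    by apply: gen_mul => //; exact: integral_ev.
  case/(maxideal_prime hO) => //; [exact: valring_ev|exact: integral_valring|].
  by move/(maxideal_ev hQ hO Ox mQ); exact/negP.
have D10 : D1 != 0 by apply: contraNneq D0 => D10; rewrite eD D10 mul0r.
have Q0 : Q != 0 by rewrite monic_neq0 // hQ.2.
have evQ0 : ev Q != 0 by rewrite -(rmorph0 ev) (inj_eq (@lev_inj _ _ _ _ L)).
have sQ : (1 < size Q)%N by case: hQ => -[].
set N := ev D * (g * z) in hDg.
have mN : maxideal O N.
  rewrite /N eD rmorphM mulrAC; apply: (maxidealM hO) => //.
  apply: (valringM hO); first exact: valring_ev.
  by apply: (valringM hO) => //; exact: integral_valring.
have q_gt1 : (1 < q)%N.
  by rewrite -{1}(expn0 #|K|) ltn_exp2l ?card_finNzRing_gt1 // -subn1 subn_gt0.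
have [r hr er] := integral_q hDg.
pose u := 1 - N ^+ q.-1.
have hpow t : integral_elt (N ^+ t).
  elim: t => [|t IHt]; first by rewrite expr0 -(rmorph1 ev); exact: integral_ev.
  by rewrite exprS; apply: gen_mul.
have hneg w : integral_elt w -> integral_elt (- w).
  move=> hw; rewrite -mulN1r; apply: gen_mul => //.
  by rewrite -(rmorph1 ev) -rmorphN; exact: integral_ev.
have hu : integral_elt u.
  by apply: gen_add; [rewrite -(rmorph1 ev); exact: integral_ev|exact: hneg].
apply: (IH D1 (g * u)) => //.
- rewrite -ltnS; apply: leq_trans sD; rewrite eD size_mul //.
  by case: (size Q) sQ => [|[|s]] // _; rewrite !addnS /= ltnS leq_addr.
- exact: gen_mul.
- case/(maxideal_prime hO) => //; try exact: integral_valring.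
  move=> mu; apply: (maxideal1 hO); rewrite -(subrK (N ^+ q.-1) 1).
  by apply: (maxidealD hO) => //; apply: (maxidealX hO) => //; rewrite -subn1 subn_gt0.
- have -> : ev D1 * (g * u * z) = - r; last exact: hneg.
  apply: (mulfI evQ0); rewrite mulrN -er /u.
  have -> : N ^+ q = N ^+ q.-1 * N by rewrite -exprSr prednK // ltnW.
  by rewrite /N eD rmorphM; ring.
Qed.

(** In [z = (g z) / g] with [g] a unit, numerator and denominator have polynomial residues [N] and
    [G]. As [G] is invertible modulo [Q], with inverse [u], the residue of [z] is that of [u N]. *)
Lemma residue_valring z : O z -> exists P, maxideal O (z - ev P).
Proof.
move=> Oz; have [g [hg ng hgz]] := integral_fraction Oz.
have [G mG] := residue_integral hg; have [N mN] := residue_integral hgz.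
have: coprimep Q G.
  rewrite (irreducible_poly_coprime _ hQ.1); apply/negP => QG; apply: ng.
  rewrite -(subrK (ev G) g); apply: (maxidealD hO) => //.
  exact/(maxideal_ev hQ hO Ox mQ).
move=> /Bezout_eq1_coprimepP [[v u] /= e1]; exists (u * N).
have -> : z - ev (u * N) =
    z * ev v * ev Q + ev u * ((g * z - ev N) - z * (g - ev G)).
  have : z = z * (ev v * ev Q + ev u * ev G) by rewrite -!rmorphM -rmorphD e1 rmorph1 mulr1.
  by move=> ez; rewrite {1}ez rmorphM; ring.
apply: (maxidealD hO); apply: (maxidealM hO) => //; try exact: valring_ev.
  by apply: (valringM hO) => //; exact: valring_ev.
by apply: (maxidealB hO) => //; apply: (maxidealM hO).
Qed.

(** The residue field is [K[x]/Q], with basis the powers of [x] below [n]. *)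
Lemma place_above_deg : place_deg iota O n.
Proof.
have Q0 : Q != 0 by rewrite monic_neq0 // hQ.2.
have sQ : (0 < size Q)%N by rewrite size_poly_gt0.
have evX (c : 'I_n -> K) :
    \sum_i iota (c i) * ev 'X ^+ i = ev (\sum_(i < n) (c i)%:P * 'X^i).
  by rewrite rmorph_sum; apply: eq_bigr => i _; rewrite rmorphM rmorphXn.
exists (fun i => ev 'X ^+ i); split; first by move=> i; apply: (valringX hO).
split=> [z Oz|c].
  have [P mP] := residue_valring Oz; exists (fun i => (P %% Q)`_i).
  have -> : \sum_(i < n) iota (P %% Q)`_i * ev 'X ^+ i = ev (P %% Q).
    rewrite evX; congr (ev _).
    have sPQ : (size (P %% Q)%R <= n)%N by rewrite -ltnS prednK // ltn_modp.
    rewrite (eq_bigr (fun i : 'I_n => (P %% Q)`_i *: 'X^i)) -?poly_def; last first.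
      by move=> i _; rewrite mul_polyC.
    apply/polyP => i; rewrite coef_poly; case: ltnP => // le_ni.
    by rewrite nth_default // (leq_trans sPQ).
  rewrite -(subrK (ev P) z) -addrA; apply: (maxidealD hO) => //.
  rewrite -rmorphB; apply/(maxideal_ev hQ hO Ox mQ).
  by rewrite {1}(divp_eq P Q) addrK dvdp_mull.
rewrite evX => /(maxideal_ev hQ hO Ox mQ) dv i.
have : \sum_(i < n) (c i)%:P * 'X^i = 0.
  apply/eqP; apply: contraT => S0; have := dvdp_leq S0 dv; rewrite leqNgt => /negP[].
  rewrite -[X in (_ < X)%N](prednK sQ) ltnS; apply: (leq_trans (size_sum _ _ _)); apply/bigmax_leqP => j _.
  by rewrite mul_polyC; apply: (leq_trans (size_scale_leq _ _)); rewrite size_polyXn.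
move=> /polyP/(_ i); rewrite coef0 coef_sum (bigD1 i) //= coefCM coefXn eqxx mulr1.
rewrite big1 ?addr0 // => j ji; rewrite coefCM coefXn (inj_eq val_inj) eq_sym.
by rewrite (negPf ji) mulr0.
Qed.
End OnePlace.

Definition shift_vec (g : {ffun 'I_k -> 'I_p}) (l : nat) : nat :=
  if insub l is Some i then g i else 0%N.

Lemma shift_vecE g (i : 'I_k) : shift_vec g i = g i.
Proof. by rewrite /shift_vec valK. Qed.

(** The places are the Galois conjugates of a single one. If [y l] has residue [A] at [O], its
    residue at the conjugate by [b] is [A + b l], so equal conjugates have equal shifts. *)
Lemma exists_places_above : exists P : 'I_(p ^ k) -> (L -> Prop),
  (forall i, [/\ valring iota (P i), P i (ev 'X) & maxideal (P i) (ev Q)]) /\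
  (forall i j, P i = P j -> i = j).
Proof.
have sQ : (1 < size Q)%N by case: hQ => -[].
have [O [hO Ox mQ]] := exists_valring_above (@lev_inj _ _ _ _ L) sQ.
have card_k : (p ^ k)%N = #|{ffun 'I_k -> 'I_p}| by rewrite card_ffun !card_ord.
pose P (i : 'I_(p ^ k)) := fun z => O (ls L (shift_vec (enum_val (cast_ord card_k i))) z).
exists P; split=> [i|i j eP].
  split; first exact: valring_ls.
    by rewrite /P ls_ev.
  by apply/maxideal_ls; rewrite ls_ev.
apply: (@cast_ord_inj _ _ card_k); apply: enum_val_inj; apply/ffunP => l; apply/val_inj.
set c := shift_vec (enum_val (cast_ord card_k i)).
set d := shift_vec (enum_val (cast_ord card_k j)).
rewrite /= -(shift_vecE (enum_val _)) -[RHS]shift_vecE -/c -/d.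
have [A mA] : exists A, maxideal O (y l - ev A).
  by apply: (residue_integral hO Ox mQ); apply: gen_base; right; exists (l : nat).
have shift (b : nat -> nat) : maxideal (fun z => O (ls L b z)) (y l - ev A - (b l)%:R).
  by apply/maxideal_ls; rewrite !rmorphB ls_ev ls_y // rmorph_nat addrAC addrK.
have := shift d; rewrite -/(P j) -eP => md; have mc := shift c.
have := maxidealB (valring_ls c hO) md mc.
have -> : y l - ev A - (d l)%:R - (y l - ev A - (c l)%:R) = iota ((c l)%:R - (d l)%:R).
  by rewrite rmorphB !rmorph_nat; ring.
move/(maxideal_const (valring_ls c hO))/eqP; rewrite subr_eq0 => /eqP.
by apply: (natr_inj_pchar pK); rewrite /c /d shift_vecE.
Qed.

End PlacesAbove.

(** * Polynomials that split completely *)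

Lemma exists_irreducible_factor (K : fieldType) (P : {poly K}) : (1 < size P)%N ->
  exists Q, monic_irreducible_poly Q /\ Q %| P.
Proof.
have [d] := ubnP (size P); elim: d P => // d IH P ltd sP.
have P0 : P != 0 by rewrite -size_poly_gt0 ltnW.
have [irr|/existsNP [Q /existsNP [sQ /existsNP [QP /negP nQP]]]] :=
    EM (forall Q : {poly K}, size Q != 1%N -> Q %| P -> Q %= P).
  have lc0 : (lead_coef P)^-1 != 0 by rewrite invr_eq0 lead_coef_eq0.
  exists ((lead_coef P)^-1 *: P); split; last by rewrite dvdpZl.
  split; last by rewrite monicE lead_coefZ mulVf // lead_coef_eq0.
  split=> [|R sR]; first by rewrite size_scale.
  by rewrite dvdpZr // => /(irr _ sR) RP; rewrite (eqp_trans RP) // eqp_sym eqp_scale.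
have Q0 : Q != 0 by apply: contraNneq P0 => Q0; rewrite -dvd0p -Q0.
have ltQP : (size Q < size P)%N.
  by rewrite ltn_neqAle dvdp_leq // andbT dvdp_size_eqp.
have sQ1 : (1 < size Q)%N.
  by have := size_poly_gt0 Q; rewrite Q0; case: (size Q) sQ => [|[]].
have [R [hR RQ]] := IH Q (leq_trans ltQP ltd) sQ1.
by exists R; split=> //; exact: dvdp_trans RQ QP.
Qed.

Section IrreducibleFactors.
Variable (K : finFieldType) (p e : nat).
Hypotheses (pK : p \in [pchar K]) (cardK : #|K| = (p ^ e)%N).

Let p_prime : prime p. Proof. exact: pcharf_prime pK. Qed.
Let p_gt1 : (1 < p)%N. Proof. exact: prime_gt1. Qed.

(** Expand [(X^p - X)^(p^s + 1)] as [(X^(p^(s+1)) - X^(p^s)) (X^p - X)]. *)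
Lemma as_polyE s : as_poly K p s =
  ('X^(p ^ s + 1)) ^+ p - 'X^(p ^ s + 1) - ('X^p - 'X) ^+ (p ^ s + 1).
Proof.
have pP : p \in [pchar {poly K}] by rewrite pchar_poly.
rewrite [X in _ - X]exprD (exprB_pow pP) expr1 -!exprM mulnDl mul1n.
rewrite -expnSr -expnS /as_poly !exprD expr1; ring.
Qed.

Lemma dvdp_trace_X s n : 'X %| \sum_(l < n) as_poly K p s ^+ (p ^ l).
Proof.
have p0 : (p == 0%N) = false by rewrite gtn_eqF // ltnW.
rewrite -['X]subr0 -polyC0 dvdp_XsubCl rootE horner_sum big1 // => l _.
rewrite horner_exp !(hornerD, hornerN, hornerMn, hornerXn) !expr0n !addn_eq0 p0 !andbF.
by rewrite subrr expr0n expn_eq0 p0.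
Qed.

Section Factor.
Variables (j : nat) (Q : {poly K}).
Hypothesis hQ : monic_irreducible_poly Q.
Local Notation q := #|K|.
Local Notation k := {poly %/ Q with hQ}.
Local Notation r := (p ^ j)%N.
Hypothesis dvQ : Q %| 'X^(q ^ r) - 'X - 1.

Let h : {rmorphism {poly K} -> k} := in_qpoly Q.
Let a : k := h 'X.

Let pk : p \in [pchar k]. Proof. exact: (rmorph_pchar (h \o @polyC K)). Qed.

Let hE P : (h P == 0) = (Q %| P). Proof. exact: in_qpoly_eq0. Qed.

Let qE t : (q ^ t = p ^ (e * t))%N. Proof. by rewrite cardK expnM. Qed.

Let a_pow : a ^+ (q ^ r) = a + 1.
Proof.
apply/eqP; rewrite -subr_eq0 opprD addrA -rmorphXn -rmorphB -(rmorph1 h) -rmorphB.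
by rewrite hE.
Qed.

(** The [q^r]-Frobenius translates [a] by 1, and this is iterated [t] times; [t = p] returns to
    [a]. *)
Let a_pow_mul t : a ^+ (q ^ (r * t)) = a + t%:R.
Proof.
elim: t => [|t IH]; first by rewrite muln0 expn0 expr1 addr0.
rewrite mulnS addnC expnD exprM IH qE exprD_pow // -qE a_pow.
suff -> : t%:R ^+ (q ^ r) = t%:R :> k by rewrite -addrA -natr1 [1 + _]addrC.
rewrite qE; elim: (e * r)%N => [|u IHu]; first by rewrite expr1.
by rewrite expnSr exprM IHu -(pFrobenius_autE pk) rmorph_nat.
Qed.

Let a_pow_p : a ^+ (q ^ (p ^ j.+1)) = a.
Proof. by rewrite expnSr a_pow_mul pcharf0 // addr0. Qed.

(** [a] generates [k] over [K], whose elements are fixed by the [q]-Frobenius. *)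
Let fixed_of_a t : a ^+ (q ^ t) = a -> forall z : k, z ^+ (q ^ t) = z.
Proof.
move=> at1 z.
have [P ->] : exists P, z = h P.
  exists (polyn (z : {poly %/ Q})); apply/esym/val_inj/in_qpoly_small; exact: size_mk_monic.
elim/poly_ind: P => [|P c IH]; first by rewrite rmorph0 expr0n expn_eq0 (gtn_eqF (ltnW (card_finNzRing_gt1 K))).
rewrite rmorphD rmorphM qE exprD_pow // -qE exprMn IH at1; congr (_ + _).
rewrite -!rmorphXn; congr (h _%:P).
by elim: t {at1 IH} => [|t IHt]; rewrite ?expn0 ?expr1 // expnSr exprM IHt expf_card.
Qed.

(** Frobenius is injective, so the exponents [t] whose [q^t]-Frobenius fixes [a] are closed under
    subtraction, and hence under gcd. *)
Let fixed_sub s t : (t <= s)%N -> a ^+ (q ^ s) = a -> a ^+ (q ^ t) = a ->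
  a ^+ (q ^ (s - t)) = a.
Proof.
move=> le_ts as1 at1.
have := as1; rewrite -{1}(subnK le_ts) expnD exprM => eq1.
apply/eqP; rewrite -subr_eq0; apply/eqP.
have : (a ^+ (q ^ (s - t)) - a) ^+ (q ^ t) = 0.
  by rewrite [(q ^ t)%N]qE exprB_pow // -!qE eq1 at1 subrr.
by move/eqP; rewrite expf_eq0 => /andP[_ /eqP].
Qed.

Let fixed_mul t u : a ^+ (q ^ t) = a -> a ^+ (q ^ (u * t)) = a.
Proof.
by move=> at1; elim: u => [|u IH]; rewrite ?expr1 // mulSn expnD exprM at1.
Qed.

(** The Frobenius with exponent [g = gcd(d, p^(j+1))] fixes [a]. If [g] were a proper divisor of
    [p^(j+1)] it would divide [p^j], giving [a = a + 1]; so [p^(j+1)] divides [d]. *)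
Lemma size_factor : (size Q).-1 = (p ^ j.+1)%N.
Proof.
set d := (size Q).-1; have sQ : (1 < size Q)%N by case: hQ => -[].
have d_gt0 : (0 < d)%N by rewrite /d -subn1 subn_gt0.
have ad : a ^+ (q ^ d) = a by rewrite -(card_qfpoly hQ) expf_card.
have q_gt1 : (1 < q)%N by exact: card_finNzRing_gt1.
(* All [q^d] elements of [k] are roots of [X^(q^(p^(j+1))) - X]. *)
have le_d : (d <= p ^ j.+1)%N.
  rewrite -(leq_exp2l _ _ q_gt1) -(card_qfpoly hQ).
  have N_gt1 : (1 < q ^ (p ^ j.+1))%N by rewrite -{1}(expn0 q) ltn_exp2l // expn_gt0 ltnW.
  have P0 : size ('X^(q ^ (p ^ j.+1)) - 'X : {poly k}) = (q ^ (p ^ j.+1)).+1.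
    by rewrite size_polyDl size_polyXn // size_polyN size_polyX.
  rewrite -ltnS -P0 cardE; apply: max_poly_roots; last exact: enum_uniq.
    by rewrite -size_poly_gt0 P0.
  apply/allP => z _; rewrite rootE !hornerE ?hornerXn subr_eq0; apply/eqP.
  exact: fixed_of_a.
pose g := gcdn d (p ^ j.+1).
have ag : a ^+ (q ^ g) = a.
  have [b _ /dvdnP [u eu]] := Bezoutl (p ^ j.+1) d_gt0.
  have -> : g = (u * d - b * p ^ j.+1)%N by rewrite -eu addnK.
  by apply: fixed_sub; rewrite -?eu ?leq_addl //; [rewrite eu|]; exact: fixed_mul.
have : (g %| p ^ j.+1)%N by exact: dvdn_gcdr.
case/(dvdn_pfactor _ _ p_prime) => i; rewrite leq_eqVlt => /orP[/eqP -> eg|].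
  by apply/eqP; rewrite eqn_leq le_d dvdn_leq // -eg dvdn_gcdl.
rewrite ltnS => le_ij eg.
have : a ^+ (q ^ r) = a by rewrite -(subnK le_ij) expnD -eg; exact: fixed_mul.
by rewrite a_pow => /eqP; rewrite -subr_eq0 addrC addKr oner_eq0.
Qed.

(** Modulo [Q], [f] is [Y^p - Y - B]. The trace of [Y^p - Y] telescopes to zero. As [a^p - a] is
    unchanged under [a |-> a + 1], [B] is fixed by the [q^r]-Frobenius, so its trace is [p] times a
    shorter sum. *)
Lemma dvdp_trace_factor s : Q %| \sum_(l < e * (size Q).-1) as_poly K p s ^+ (p ^ l).
Proof.
rewrite size_factor -hE rmorph_sum /=; apply/eqP.
pose Y := a ^+ (p ^ s + 1); pose B := (a ^+ p - a) ^+ (p ^ s + 1).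
have ef : h (as_poly K p s) = Y ^+ p - Y - B.
  by rewrite as_polyE !rmorphB !rmorphXn rmorphB rmorphXn.
have eB : B ^+ (p ^ (e * r)) = B.
  rewrite /B exprAC exprB_pow // -qE [a ^+ p ^+ _]exprAC a_pow.
  by congr (_ ^+ _); rewrite exprD_pchar // expr1n; ring.
rewrite (eq_bigr (fun l : 'I_ _ => (Y ^+ (p ^ l.+1) - Y ^+ (p ^ l)) - B ^+ (p ^ l))); last first.
  by move=> l _; rewrite rmorphXn ef !exprB_pow // -exprM -expnS.
rewrite sumrB -(big_mkord xpredT (fun l => Y ^+ (p ^ l.+1) - Y ^+ (p ^ l))).
rewrite telescope_sumr // -qE (fixed_of_a a_pow_p) expn0 expr1 subrr sub0r.
suff tr t : \sum_(l < e * r * t) B ^+ (p ^ l) = (\sum_(l < e * r) B ^+ (p ^ l)) *+ t.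
  by rewrite expnSr mulnA tr -mulr_natr pcharf0 // mulr0 oppr0.
elim: t => [|t IH]; first by rewrite muln0 big_ord0.
rewrite mulnS big_split_ord /= mulrS -IH; congr (_ + _); apply: eq_bigr => l _.
by rewrite expnD exprM eB.
Qed.

End Factor.

Lemma exists_split_poly i : exists Q : {poly K}, [/\ monic_irreducible_poly Q,
  (size Q).-1 = (p ^ i)%N &
  forall s, Q %| \sum_(l < e * (size Q).-1) as_poly K p s ^+ (p ^ l)].
Proof.
case: i => [|j].
  exists 'X; rewrite size_polyX; split=> // [|s]; last exact: dvdp_trace_X.
  split; last exact: monicX.
  by rewrite -['X]subr0 -polyC0; exact: irredp_XsubC.
have [|Q [hQ dvQ]] := @exists_irreducible_factor K ('X^(#|K| ^ (p ^ j)) - 'X - 1).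
  have N_gt1 : (1 < #|K| ^ (p ^ j))%N.
    by rewrite -{1}(expn0 #|K|) ltn_exp2l ?card_finNzRing_gt1 // expn_gt0 ltnW.
  rewrite -addrA size_polyDl ?size_polyXn ?ltnS; first exact: ltnW.
  rewrite -opprD size_polyN size_polyDl ?size_polyX ?size_poly1 //.
exists Q; split=> //; first exact: size_factor dvQ.
exact: dvdp_trace_factor dvQ.
Qed.

End IrreducibleFactors.

(** * Places and genus of a level *)

Lemma NoDup_map_inj (I : eqType) (T : Type) (g : I -> T) (s : seq I) :
  (forall i j, g i = g j -> i = j) -> uniq s -> List.NoDup (map g s).
Proof.
move=> g_inj; elim: s => [|i s IH] /=; first by constructor.
move=> /andP[nis us]; constructor; last exact: IH.
elim: s nis {us IH} => [_ []|j s IH] /=; rewrite inE negb_or => /andP[ij nis] [/g_inj eij|].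
  by rewrite eij eqxx in ij.
exact: IH.
Qed.

Lemma In_map (I : eqType) (T : Type) (g : I -> T) (s : seq I) t :
  List.In t (map g s) <-> exists2 i, i \in s & t = g i.
Proof.
elim: s => [|i s IH] /=; first by split=> // -[].
split=> [[<-|/IH [j js ->]]|[j]]; first by exists i; rewrite ?mem_head.
  by exists j; rewrite // in_cons js orbT.
rewrite in_cons => /orP[/eqP ->|js] et; first by left.
by right; apply/IH; exists j.
Qed.

Section LevelInvariants.
Variables (K : finFieldType) (p a c k : nat).
Variable L : level p (fun j => as_poly K p (c + j)) k.
Hypotheses (pK : p \in [pchar K]) (c_gt0 : (0 < c)%N) (pa_lt : (p * a < p ^ c)%N).
Local Notation ev := (lev L).
Local Notation iota := (consts ev).
Local Notation x := (ev 'X).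

Let x0 : x != 0.
Proof. by rewrite -(rmorph0 ev) (inj_eq (@lev_inj _ _ _ _ L)) polyX_eq0. Qed.

Lemma level_places i N : (N <= p ^ k)%N -> places_ge iota (p ^ i) N.
Proof.
move=> leN; have cardK := card_pprimeChar pK.
have [Q [hQ sQ tr]] := exists_split_poly pK cardK i.
have trk j : (j < k)%N -> _ := fun=> tr (c + j)%N.
have [P [hP P_inj]] := exists_places_above L pK cardK hQ trk.
exists (fun i => P (widen_ord leN i)); split=> [l|l l' /P_inj /(congr1 val) /= h].
  have [vP Px mQ] := hP (widen_ord leN l); split=> //; rewrite -sQ.
  exact: (place_above_deg pK cardK hQ trk).
exact: val_inj.
Qed.

Lemma val_ge_valring O z : valring iota O -> val_ge O z 0 -> O z.
Proof.
move=> hO [->|[t [u [n [[[Ot _] _] [_ [Ou _]] n_ge0 ->]]]]]; first exact: (valring0 hO).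
by case: n n_ge0 => // n _; apply: (valringM hO) => //; exact: (valringX hO).
Qed.

(** A prime element [t] divides [x], so [x^a] compensates a pole of order [a]. *)
Lemma val_ge_scaled O z : valring iota O -> maxideal O x -> val_ge O z (- a%:Z) ->
  O (x ^+ a * z).
Proof.
move=> hO mx [->|[t [u [n [[[Ot _] tP] [_ [Ou _]] len ->]]]]].
  by rewrite mulr0; exact: (valring0 hO).
have [w [Ow ex]] := tP _ mx.
have t0 : t != 0 by apply: contraNneq x0 => t0; rewrite ex t0 mul0r.
have -> : x ^+ a * (t ^ n * u) = w ^+ a * (t ^ (a%:Z + n) * u).
  by rewrite ex exprMn expfzDr // -exprnP; ring.
have : 0 <= a%:Z + n by rewrite -lerBlDl sub0r.
case: (a%:Z + n) => // l _.
by apply: (valringM hO); [exact: (valringX hO)|apply: (valringM hO) => //; exact: (valringX hO)].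
Qed.

Lemma level_genus : genus_ge iota (a%:R * (p%:R ^+ k - 1)).
Proof.
have cardK := card_pprimeChar pK.
have hX : monic_irreducible_poly ('X : {poly K}).
  split; last exact: monicX.
  by rewrite -['X]subr0 -polyC0; exact: irredp_XsubC.
have tr j : (j < k)%N -> _ := fun=> dvdp_trace_X pK (c + j) _.
have [P [hP P_inj]] := exists_places_above L pK cardK hX (tr _).
have Pdeg i : place_deg iota (P i) 1.
  have [vP Px mX] := hP i.
  by have := place_above_deg pK cardK hX (tr _) vP Px mX; rewrite size_polyX.
pose A := [seq (P i, a%:Z, 1%N) | i <- enum 'I_(p ^ k)].
(* [a.+1] counts the coefficients of a polynomial of degree at most [a]; the genus bound becomes
   [a p^k - (a + 1) + 1]. *)
exists A, a.+1; split.
- split=> [O b d /In_map [i _ [-> _ ->]]|]; first by case: (hP i).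
  by rewrite -map_comp; apply: NoDup_map_inj => //; exact: enum_uniq.
- move=> y yL.
  (* Multiplication by [x^a] clears the permitted poles above [x = 0] and creates poles only at
     infinity. *)
  have yb i : bounded ev a (x ^+ a * y i).
    move=> O hO; have [inA outA] := yL i O hO.
    have [[j eO]|nO] := EM (exists j, O = P j).
      have [_ Px mX] := hP j; rewrite eO; split=> //; rewrite -eO => _.
      apply: (val_ge_scaled hO); first by rewrite eO.
      by apply: (inA _ 1%N); apply/In_map; exists j; rewrite ?mem_enum // eO.
    have Oy : O (y i).
      apply: (val_ge_valring hO); apply: outA => b d /In_map [j _ [eO _ _]].
      by apply: nO; exists j.
    split=> [Ox|_]; first by apply: (valringM hO) => //; exact: (valringX hO).
    by rewrite mulrC mulKf // expf_neq0.
  have /choice [R hR] : forall i, exists R : {poly K},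
      (size R <= a.+1)%N /\ x ^+ a * y i = ev R.
    by move=> i; have [R sR eR] := bounded_poly pK c_gt0 pa_lt (yb i); exists R.
  (* The [a.+2] coefficient rows of length [a.+1] are dependent; a left kernel vector gives the
     relation. *)
  pose M : 'M[K]_(a.+2, a.+1) := \matrix_(i, j) (R i)`_j.
  have : kermx M != 0.
    rewrite kermx_eq0 /row_free; apply: contraTneq (rank_leq_col M) => ->.
    by rewrite -ltnNge.
  case/rowV0Pn => v /sub_kermxP vM v0; exists (fun i => v 0 i); split.
    apply: contrapT => nv; case/negP: v0; apply/eqP/rowP => i; rewrite mxE.
    by apply/eqP; apply: contraT => vi; case: nv; exists i.
  apply: (mulfI (expf_neq0 a x0)); rewrite mulr0 big_distrr /=.
  transitivity (ev (\sum_i (v 0 i)%:P * R i)).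
    rewrite rmorph_sum; apply: eq_bigr => i _.
    by rewrite rmorphM -(hR i).2 mulrCA.
  rewrite -[RHS](rmorph0 ev); congr (ev _); apply/polyP => j; rewrite coef0 coef_sum.
  have [ltj|lej] := ltnP j a.+1; last first.
    by apply: big1 => i _; rewrite coefCM nth_default ?mulr0 // (leq_trans (hR i).1).
  have /rowP/(_ (Ordinal ltj)) := vM; rewrite !mxE => eM; rewrite -[RHS]eM.
  by apply: eq_bigr => i _; rewrite coefCM !mxE.
- have -> : div_deg A = a%:Z * (p ^ k)%:Z.
    rewrite /div_deg big_map /= (eq_bigr (fun=> a%:Z)); last by move=> i _; rewrite mulr1.
    by rewrite big_enum sumr_const card_ord -mulr_natr natz.
  rewrite !(rmorphD, rmorphB, rmorphM, rmorphN) /= -!pmulrn natrX -natr1.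
  by rewrite le_eqVlt; apply/orP; left; apply/eqP; ring.
Qed.

End LevelInvariants.

(** * Construction of the tower *)

Section QuotientField.
Variables (F : fieldType) (h : {poly F}) (hI : monic_irreducible_poly h).
Local Notation E := {poly %/ h with hI}.

Definition qproj : {rmorphism {poly F} -> E} := in_qpoly h.
Definition qrepr (z : E) : {poly F} := polyn (z : {poly %/ h}).

Lemma qreprK z : qproj (qrepr z) = z.
Proof. by apply/val_inj/in_qpoly_small; exact: size_mk_monic. Qed.

Lemma size_qrepr z : (size (qrepr z) < size h)%N.
Proof. by rewrite (leq_trans (size_mk_monic (z : {poly %/ h}))) // (mk_monicE hI). Qed.

Lemma qproj_eq0 P : (qproj P == 0) = (h %| P).
Proof. exact: in_qpoly_eq0. Qed.

Variables (M : fieldType) (psi : {rmorphism {poly F} -> M}).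
Hypothesis psih : psi h = 0.

Let lift (z : E) := psi (qrepr z).

Let lift_proj P : lift (qproj P) = psi P.
Proof.
apply/eqP; rewrite -subr_eq0 /lift -rmorphB.
have : qproj (qrepr (qproj P) - P) == 0 by rewrite rmorphB qreprK subrr.
by rewrite qproj_eq0 => /dvdpP [R ->]; rewrite rmorphM psih mulr0.
Qed.

Let lift_zmod : zmod_morphism lift.
Proof. by move=> z w; rewrite -{1}(qreprK z) -{1}(qreprK w) -rmorphB lift_proj rmorphB. Qed.

Let lift_monoid : monoid_morphism lift.
Proof.
split; first by rewrite -(rmorph1 qproj) lift_proj rmorph1.
by move=> z w; rewrite -{1}(qreprK z) -{1}(qreprK w) -rmorphM lift_proj rmorphM.
Qed.

Definition qlift : {rmorphism E -> M} :=
  HB.pack lift (GRing.isZmodMorphism.Build E M lift lift_zmod)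
    (GRing.isMonoidMorphism.Build E M lift lift_monoid).

Lemma qlift_proj P : qlift (qproj P) = psi P.
Proof. exact: lift_proj. Qed.

End QuotientField.

(** * Irreducibility of Artin-Schreier polynomials *)

Section ArtinSchreier.
Variables (F : fieldType) (p : nat) (g : F).
Hypothesis pF : p \in [pchar F].

Let p_prime : prime p. Proof. exact: pcharf_prime pF. Qed.
Let p_gt1 : (1 < p)%N. Proof. exact: prime_gt1. Qed.

Definition as_eqn : {poly F} := 'X^p - 'X - g%:P.

Lemma size_as_eqn : size as_eqn = p.+1.
Proof.
rewrite /as_eqn -addrA size_polyDl size_polyXn // -opprD size_polyN.
rewrite size_polyDl ?size_polyX ?size_polyC //.
by case: (g != 0).
Qed.

Lemma monic_as_eqn : as_eqn \is monic.
Proof.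
rewrite monicE lead_coefE size_as_eqn /= !coefB coefXn eqxx coefX coefC.
by rewrite !gtn_eqF ?subr0 // ltnW.
Qed.

Hypothesis no_root : forall z : F, z ^+ p - z <> g.

(* The roots in an extension are [b + i], so a proper factor has trace
   [d b + n] with [0 < d < p], which puts [b] in the base field. *)
Lemma irreducible_as_eqn : irreducible_poly as_eqn.
Proof.
split=> [|D sD dvD]; first by rewrite size_as_eqn ltnS ltnW.
have A0 : as_eqn != 0 by exact: monic_neq0 monic_as_eqn.
(* Adjoining a root of one irreducible factor is enough, as the other roots are its translates by
   the prime field. *)
have [|Q [hQ dvQ]] := @exists_irreducible_factor F as_eqn.
  by rewrite size_as_eqn ltnS ltnW.
pose E := {poly %/ Q with hQ}; pose pr : {rmorphism {poly F} -> E} := qproj hQ.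
pose i := consts pr; pose b := pr 'X.
have pE : p \in [pchar E] by exact: (rmorph_pchar i).
have eb : b ^+ p - b = i g.
  apply/eqP; rewrite -subr_eq0 -rmorphXn -!rmorphB.
  by rewrite [_ == 0](qproj_eq0 hQ).
pose rs : seq E := [seq b + n%:R | n <- iota 0 p].
have eA : map_poly i as_eqn = \prod_(z <- rs) ('X - z%:P).
  have := @all_roots_prod_XsubC E (map_poly i as_eqn) rs.
  rewrite size_map_poly size_as_eqn size_map size_iota => /(_ erefl).
  rewrite lead_coef_map (monicP monic_as_eqn) rmorph1 scale1r; apply.
    apply/allP => _ /mapP [n _ ->]; rewrite rootE !rmorphB rmorphXn /= map_polyX map_polyC.
    rewrite !hornerE ?hornerXn exprD_pchar // natr_expp //.
    by rewrite opprD addrACA subrr addr0 subr_eq0; apply/eqP; exact: eb.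
  rewrite uniq_rootsE map_inj_in_uniq ?iota_uniq // => n n'.
  rewrite !mem_iota !add0n /= => ltn ltn' /addrI; exact: (natr_inj_pchar pE ltn ltn').
have : map_poly i D %| \prod_(z <- rs) ('X - z%:P) by rewrite -eA dvdp_map.
case/dvdp_prod_XsubC => m; set ts := mask m rs => eD.
have sts : size D = (size ts).+1.
  by rewrite -(size_map_poly i) (eqp_size eD) size_prod_XsubC.
have [le_p|lt_p] := leqP p (size ts).
  rewrite -dvdp_size_eqp // size_as_eqn sts eqSS eqn_leq le_p andbT.
  by rewrite -ltnS -sts -size_as_eqn dvdp_leq.
have ts0 : size ts != 0 by move: sD; rewrite sts.
have [n en] : exists n, \sum_(z <- ts) z = (size ts)%:R * b + n%:R.
  have : {subset ts <= rs} by move=> z; exact: mem_mask.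
  elim: (ts) => [|z s IH] sub; first by exists 0%N; rewrite big_nil mul0r addr0.
  have [|n en] := IH; first by move=> w ws; apply: sub; rewrite in_cons ws orbT.
  have /mapP [n' _ ez] := sub z (mem_head _ _).
  by exists (n + n')%N; rewrite big_cons en ez /= -natr1 natrD; ring.
(* The trace is also a coefficient of the factor. *)
have [s es] : exists s, \sum_(z <- ts) z = i s.
  have lcD : lead_coef D != 0.
    by rewrite lead_coef_eq0; apply: contraNneq A0 => D0; rewrite -dvd0p -D0.
  exists (- (D`_(size ts).-1 / lead_coef D)); rewrite rmorphN -[LHS]opprK; congr (- _).
  rewrite -coefPn_prod_XsubC // fmorph_div -lead_coef_map -coef_map.
  have /eqpP [[u v] /= /andP[u0 v0] euv] := eD.
  have := congr1 lead_coef euv; rewrite !lead_coefZ (monicP (monic_prod_XsubC _ _ _)) mulr1.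
  move=> ev; have := congr1 (fun P : {poly E} => P`_(size ts).-1) euv; rewrite !coefZ -ev.
  rewrite -mulrA => /(mulfI u0) ->; rewrite mulrC mulKf //.
  by rewrite lead_coef_map fmorph_eq0.
have d0 : (size ts)%:R != 0 :> E.
  by rewrite -(dvdn_pcharf pE) gtnNdvd // lt0n.
exfalso; apply: (no_root (z := (s - n%:R) / (size ts)%:R)).
apply: (fmorph_inj i); rewrite -eb rmorphB rmorphXn.
suff -> : i ((s - n%:R) / (size ts)%:R) = b by [].
by rewrite fmorph_div rmorphB !rmorph_nat -es en addrK mulrC mulKf.
Qed.

Lemma monic_irreducible_as_eqn : monic_irreducible_poly as_eqn.
Proof. by split; [exact: irreducible_as_eqn|exact: monic_as_eqn]. Qed.

End ArtinSchreier.

(** * Adjoining the next Artin-Schreier root *)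

Section NextLevel.
Variables (K : fieldType) (p : nat) (f : nat -> {poly K}) (k : nat) (L : level p f k).
Hypothesis pK : p \in [pchar K].
Hypothesis no_root : forall z : L, z ^+ p - z <> lev L (f k).

Let p_prime : prime p. Proof. exact: pcharf_prime pK. Qed.
Let p_gt1 : (1 < p)%N. Proof. exact: prime_gt1. Qed.
Let pL : p \in [pchar L]. Proof. exact: (pchar_field (lev L) pK). Qed.

Let h : {poly L} := as_eqn p (lev L (f k)).
Let hI : monic_irreducible_poly h := monic_irreducible_as_eqn pL no_root.
Let E : fieldType := {poly %/ h with hI}.
Let pr : {rmorphism {poly L} -> E} := qproj hI.

Definition next_emb : {rmorphism L -> E} := consts pr.
Local Notation emb := next_emb.
Let yk : E := pr 'X.

Let pE : p \in [pchar E]. Proof. exact: (pchar_field pr pL). Qed.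

Let pr_horner P : (map_poly emb P).[yk] = pr P. Proof. exact: ev_horner. Qed.

Let yk_eq : yk ^+ p - yk = emb (lev L (f k)).
Proof.
apply/eqP; rewrite -subr_eq0 -rmorphXn -!rmorphB.
by rewrite [_ == 0](qproj_eq0 hI).
Qed.

Let ev' : {rmorphism {poly K} -> E} := emb \o lev L.
Let y' j : E := if (j < k)%N then emb (ly L j) else yk.

Let shift_poly (c : nat -> nat) : {rmorphism {poly L} -> E} :=
  horner_eval (yk + (c k)%:R) \o map_poly (emb \o ls L c).

Let shift_polyE c P : shift_poly c P = (map_poly (emb \o ls L c) P).[yk + (c k)%:R].
Proof. by []. Qed.

(** Adding an element of the prime field does not change [y_k^p - y_k], and [ls L c] fixes [f k].
    Hence the substitution descends to the quotient and extends the automorphism. *)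
Let shift_poly0 c : shift_poly c h = 0.
Proof.
rewrite shift_polyE !rmorphB rmorphXn /= map_polyX map_polyC.
rewrite !(hornerD, hornerN, hornerC, hornerXn, hornerX) exprD_pchar // natr_expp //.
rewrite opprD addrACA subrr addr0 yk_eq; apply/eqP; rewrite subr_eq0; apply/eqP.
exact: (congr1 emb (esym (ls_ev L c (f k)))).
Qed.

Let s' (c : nat -> nat) : {rmorphism E -> E} := qlift hI (shift_poly0 c).

Let s'_pr c P : s' c (pr P) = shift_poly c P. Proof. exact: qlift_proj. Qed.

Let s'_emb c z : s' c (emb z) = emb (ls L c z).
Proof. by rewrite s'_pr shift_polyE map_polyC hornerC. Qed.

Let s'_yk c : s' c yk = yk + (c k)%:R.
Proof. by rewrite s'_pr shift_polyE map_polyX hornerX. Qed.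

Let rational_emb z : rational (lev L) z -> rational ev' (emb z).
Proof.
move=> [P [Q [Q0 ->]]]; exists P, Q; rewrite fmorph_div; split=> //.
by rewrite fmorph_eq0.
Qed.

Lemma ls_trivial c (z : L) : (forall j, (j < k)%N -> c j = 0%N) -> ls L c z = z.
Proof.
move=> c0; elim: (l_gen z) => {z} [z [rz|[j ltj ->]]|z w _ ez _ ew|z w _ ez _ ew].
- exact: ls_rational.
- by rewrite ls_y // c0 // addr0.
- by rewrite rmorphD ez ew.
- by rewrite rmorphM ez ew.
Qed.

Let elt_repr z : exists2 P : {poly L}, (size P <= p)%N & z = pr P.
Proof.
exists (qrepr z); last by rewrite /pr qreprK.
by rewrite -ltnS -(size_as_eqn (lev L (f k)) pL) size_qrepr.
Qed.

Let emb_coef z : exists c : 'I_p -> L, z = \sum_(i < p) emb (c i) * yk ^+ i.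
Proof.
have [P sP ->] := elt_repr z; exists (fun i => P`_i).
rewrite -pr_horner (@horner_coef_wide _ p) ?size_map_poly //.
by apply: eq_bigr => i _; rewrite coef_map.
Qed.

(* Invariance under [X |-> X + 1] forces [P - P(0)] to vanish on the prime field. *)
Let fixed_emb z : s' (unit_vec k) z = z -> exists w, z = emb w.
Proof.
have [P sP ->] := elt_repr z; rewrite s'_pr shift_polyE /unit_vec eqxx => eP.
(* Both sides have degree below [p], so congruence modulo [h] is equality. *)
have eP' : P \Po ('X + 1) = P.
  apply/eqP; rewrite -subr_eq0; apply: contraT => PP0.
  have : pr (P \Po ('X + 1) - P) == 0.
    rewrite rmorphB subr_eq0 -eP -pr_horner; apply/eqP.
    rewrite map_comp_poly rmorphD rmorph1 /= map_polyX horner_comp !hornerE.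
    congr (_.[_]); apply/polyP => i; rewrite !coef_map /= ls_trivial // => j ltj.
    by rewrite ltn_eqF.
  rewrite (qproj_eq0 hI) => /(dvdp_leq PP0); rewrite size_as_eqn // ltnNge.
  have -> // : (size (P \Po ('X + 1) - P)%R <= p)%N.
  apply: (leq_trans (size_polyD _ _)); rewrite geq_max size_polyN sP andbT.
  by rewrite -polyC1 size_comp_poly2 // size_XaddC.
have Pn n : P.[n%:R] = P.[0].
  elim: n => [//|n IH]; rewrite -IH -[in RHS]eP' horner_comp !hornerE.
  by rewrite natr1.
exists P.[0]; have -> : P = (P.[0])%:P; last by rewrite hornerC.
apply/eqP; rewrite -subr_eq0; apply: contraT => PP0.
have sP' : (size (P - (P.[0])%:P)%R <= p)%N.
  apply: (leq_trans (size_polyD _ _)); rewrite geq_max size_polyN sP.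
  by rewrite (leq_trans (size_polyC_leq1 _)) // ltnW.
have : (size [seq n%:R : L | n <- iota 0 p] < size (P - (P.[0])%:P)%R)%N.
  apply: max_poly_roots => //.
    by apply/allP => _ /mapP [n _ ->]; rewrite rootE !hornerE Pn subrr.
  rewrite map_inj_in_uniq ?iota_uniq // => n n'.
  by rewrite !mem_iota !add0n /= => ltn ltn'; exact: (natr_inj_pchar pL ltn ltn').
by rewrite size_map size_iota ltnNge sP'.
Qed.

(** Transparent, so that its field reduces to [E], the codomain of [next_emb]. *)
Definition next_level : level p f k.+1.
Proof.
apply: (@Level K p f k.+1 E ev' y' s').
- exact: inj_comp (fmorph_inj _) (@lev_inj _ _ _ _ L).
- move=> j; rewrite ltnS leq_eqVlt /y' => /orP[/eqP ->|ltj]; first by rewrite ltnn.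
  by rewrite ltj -rmorphXn -rmorphB ly_eq.
- by move=> c P; rewrite s'_emb ls_ev.
- move=> c j; rewrite ltnS leq_eqVlt /y' => /orP[/eqP ->|ltj]; first by rewrite ltnn s'_yk.
  by rewrite ltj s'_emb ls_y // rmorphD rmorph_nat.
- move=> z; have [P _ ->] := elt_repr z; rewrite -pr_horner.
  pose B u := rational ev' u \/ exists2 j, (j < k.+1)%N & u = y' j.
  have gemb w : subring_gen B (emb w).
    elim: (l_gen w) => {w} [w [rw|[j ltj ->]]|w v _ gw _ gv|w v _ gw _ gv].
    + by apply: gen_base; left; exact: rational_emb.
    + by apply: gen_base; right; exists j; [exact: ltnW|rewrite /y' ltj].
    + by rewrite rmorphD; exact: gen_add.
    + by rewrite rmorphM; exact: gen_mul.
  elim/poly_ind: P => [|P c IH].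
    by rewrite rmorph0 horner0 -(rmorph0 emb).
  rewrite rmorphD rmorphM /= map_polyX map_polyC hornerMXaddC.
  apply: gen_add; [apply: gen_mul; [exact: IH|]|exact: (gemb c)].
   apply: gen_base; right; exists k => //.
  by rewrite /y' ltnn.
- move=> z fix_z; have [w ew] := fixed_emb (fix_z k (leqnn _)).
  rewrite ew; apply/rational_emb/l_fix => j ltj; apply: (fmorph_inj emb).
  by rewrite -s'_emb -ew; apply: fix_z; exact: ltnW.
- have [T [b hb]] := l_fin L.
  exists ('I_p * T)%type, (fun u : 'I_p * T => yk ^+ u.1 * emb (b u.2)) => z.
  have [c ->] := emb_coef z.
  have /choice [r hr] : forall i : 'I_p, exists r : T -> L,
     (forall t, rational (lev L) (r t)) /\ c i = \sum_t r t * b t by move=> i; exact: hb.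
  exists (fun u => emb (r u.1 u.2)); split=> [u|].
    by apply: rational_emb; exact: (hr u.1).1.
  rewrite -(pair_bigA _ (fun i t => emb (r i t) * (yk ^+ i * emb (b t)))).
  apply: eq_bigr => i _; rewrite (hr i).2 (rmorph_sum emb) mulr_suml.
  apply: eq_bigr => t _.
  by rewrite rmorphM -mulrA [emb (b t) * _]mulrC.
Defined.

Lemma next_finite : finite_ext emb.
Proof. by exists p, (fun i => yk ^+ i) => z; exact: emb_coef. Qed.

Lemma next_proper : proper_ext emb.
Proof.
exists yk => z; apply/eqP => ez; apply: (no_root (z := z)).
by apply: (fmorph_inj emb); rewrite rmorphB rmorphXn ez yk_eq.
Qed.

(** The derivative of [X^p - X - g] is -1, so [yk] is separable, and with it the whole field that it
    generates. *)
Lemma next_separable : separable_ext emb.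
Proof.
(* [M] is [E] viewed as an [L]-algebra; [emb] agrees with its structure map. *)
move=> z; pose M : fieldExtType L := {poly %/ h with hI}.
have embE (P : {poly L}) : map_poly emb P = map_poly (in_alg M) P :> {poly M}.
  apply/polyP => i; rewrite !coef_map.
  change (in_qpoly h (P`_i)%:P = P`_i *: (1 : {poly %/ h})).
  by rewrite -alg_polyC in_qpolyZ in_qpoly1.
have sy : @separable_element _ M 1%AS yk.
  apply/separable_elementP; exists (map_poly (in_alg M) h); split.
  - by apply/polyOver1P; exists h.
  - rewrite -embE rootE pr_horner.
    by rewrite [_ == 0](qproj_eq0 hI).
  - rewrite separable_map unlock.
    have -> : h^`() = (-1) *: 1.
      rewrite /h /as_eqn !derivB derivXn derivX derivC subr0 scaleN1r.
      have pP : p \in [pchar {poly L}] by rewrite pchar_poly.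
      by rewrite -mulr_natr (pcharf0 pP) mulr0 sub0r.
    by rewrite coprimepZr ?oppr_eq0 ?oner_eq0 // coprimep1.
have /separableP/(_ z) : @separable _ M 1%AS <<1%AS; yk>>%AS.
  by rewrite -adjoin_separable_eq.
have zy : (z : M) \in (<<1%AS; yk>>%AS : {subfield M}).
  have [P _ ->] := elt_repr z; rewrite -pr_horner embE.
  by apply: mempx_Fadjoin; apply/polyOver1P; exists P.
move=> /(_ zy) /separable_elementP [g [/polyOver1P [g' eg] gz sg]].
rewrite eg separable_map in sg; rewrite eg -embE in gz.
exists g'; split=> //; exact: separable_poly_neq0.
Qed.

End NextLevel.

Lemma fraction_repr (R : idomainType) (z : {fraction R}) : exists n d : R,
  d != 0 /\ z = FracField.tofrac n / FracField.tofrac d.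
Proof.
elim/quotW: z => r; exists (frac r).1, (frac r).2; have d0 := denom_ratioP r.
split=> //; apply: (mulIf (_ : FracField.tofrac (frac r).2 != 0)); first by rewrite tofrac_eq0.
rewrite divfK ?tofrac_eq0 //; unlock FracField.tofrac.
rewrite -[LHS]FracField.pi_mul; apply/eqmodP; rewrite /= FracField.equivfE.
by rewrite /FracField.mulf !numden_Ratio ?mulr1 ?oner_eq0 // mulrC.
Qed.

Definition base_level (K : fieldType) (p : nat) (f : nat -> {poly K}) : level p f 0.
Proof.
have rat (z : {fraction {poly K}}) : rational (@FracField.tofrac {poly K}) z.
  by have [n [d [d0 ez]]] := fraction_repr z; exists n, d; rewrite tofrac_eq0.
apply: (@Level K p f 0 {fraction {poly K}} (@FracField.tofrac {poly K})
  (fun=> 0) (fun=> idfun)) => //.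
- by move=> P Q /eqP; rewrite tofrac_eq => /eqP.
- by move=> z; apply: gen_base; left.
- exists unit, (fun=> 1) => z; exists (fun=> z); split=> //.
  by rewrite big_const card_unit /= mulr1 addr0.
Defined.

(** The [p] elements of the prime field already exhaust the roots of [X^p - X]. *)
Lemma expp_fixed (p : nat) (F : fieldType) (d : F) : p \in [pchar F] -> d ^+ p = d ->
  exists n : nat, d = n%:R.
Proof.
move=> pF dp; have p_gt1 : (1 < p)%N by exact/prime_gt1/(pcharf_prime pF).
have sX : size ('X^p - 'X : {poly F}) = p.+1.
  by rewrite size_polyDl size_polyXn // size_polyN size_polyX.
have X0 : 'X^p - 'X != 0 :> {poly F} by rewrite -size_poly_gt0 sX.
have [/mapP [n _ ->]|nd] := boolP (d \in [seq n%:R | n <- iota 0 p]); first by exists n.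
have := max_poly_roots (rs := d :: [seq n%:R | n <- iota 0 p]) X0.
rewrite sX /= size_map size_iota ltnn => h; suff: false by [].
apply: h; last first.
  rewrite nd map_inj_in_uniq ?iota_uniq // => n n'.
  by rewrite !mem_iota !add0n /= => ltn ltn'; exact: (natr_inj_pchar pF ltn ltn').
rewrite rootE hornerD hornerN hornerXn hornerX dp subrr eqxx /=.
apply/allP => _ /mapP [n _ ->].
by rewrite rootE hornerD hornerN hornerXn hornerX natr_expp // subrr.
Qed.

(** * Nontriviality of each step and iteration *)

Section TowerConstruction.
Variables (K : fieldType) (p c : nat).
Hypotheses (pK : p \in [pchar K]) (c_gt0 : (0 < c)%N).
Local Notation f := (fun j => as_poly K p (c + j)).

(** For a root [z], each [ldiff j z] is fixed by the [p]-th power map, so it lies in the prime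
    field. Then [z] minus a constant combination of the [y_j] is rational, against independence with
    [a = 0]. *)
Lemma as_poly_no_root k (L : level p f k) (z : L) : z ^+ p - z <> lev L (f k).
Proof.
move=> ez; have pL := pchar_field (lev L) pK.
have /choice [n hn] : forall j, exists n : nat, ldiff j z = n%:R.
  move=> j; apply: (expp_fixed pL); apply/eqP; rewrite -subr_eq0.
  have es : ls L (unit_vec j) z ^+ p - ls L (unit_vec j) z = z ^+ p - z.
    by rewrite -rmorphXn -rmorphB ez ls_ev.
  rewrite /ldiff.
  have -> : (ls L (unit_vec j) z - z) ^+ p = ls L (unit_vec j) z ^+ p - z ^+ p.
    by apply/eqP; rewrite eq_sym subr_eq -exprD_pchar // subrK.
  have -> : ls L (unit_vec j) z ^+ p - z ^+ p - (ls L (unit_vec j) z - z) =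
      (ls L (unit_vec j) z ^+ p - ls L (unit_vec j) z) - (z ^+ p - z) by ring.
  by rewrite es subrr.
pose e := z - \sum_(j < k) (n j)%:R * ly L j.
have re : rational (lev L) e.
  apply: (@rational_sub_comb _ _ _ _ L (fun j => (n j)%:R)) => // j _; exact: rational_natr.
(* The root [z] is treated as one more [y_k], with coefficient 1; the resulting combination is zero,
   hence bounded. *)
pose cf j : {poly K} := if (j < k)%N then - (n j)%:R else 1.
pose y j := if (j < k)%N then ly L j else z.
suff : cf k = 0 by apply/eqP; rewrite /cf ltnn oner_eq0.
have pc : (p * 0 < p ^ c)%N by rewrite muln0 expn_gt0 (ltnW (prime_gt1 (pcharf_prime pK))).
apply: (bounded_as_independent (a := 0) (y := y) (k := k.+1) (e := - e) pK (@lev_inj _ _ _ _ L) c_gt0 pc) => //.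
- move=> j; rewrite ltnS leq_eqVlt /y => /orP[/eqP ->|ltj]; first by rewrite ltnn.
  by rewrite ltj ly_eq.
- move=> j; rewrite /cf; case: ifP => _; last by rewrite size_poly1.
  by rewrite size_polyN -polyC_natr size_polyC_leq1.
- by rewrite -sub0r; apply: rationalB => //; exact: (rational_natr L 0).
- have -> : \sum_(j < k.+1) lev L (cf j) * y j - e = 0.
    rewrite big_ord_recr /= /cf /y ltnn rmorph1 mul1r /e opprB addrC -addrA.
    rewrite (eq_bigr (fun j : 'I_k => - ((n j)%:R * ly L j))); last first.
      by move=> j _; rewrite ltn_ord rmorphN rmorph_nat mulNr.
    by rewrite sumrN; ring.
  by move=> O hO; rewrite mul0r; split=> _; exact: (valring0 hO).
Qed.

Fixpoint tower_level k : level p f k :=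
  if k is k'.+1 then next_level pK (@as_poly_no_root k' (tower_level k'))
  else base_level p f.

End TowerConstruction.

Lemma genus_ge_le (K F : fieldType) (iota : {rmorphism K -> F}) (G H : rat) :
  G <= H -> genus_ge iota H -> genus_ge iota G.
Proof. by move=> GH [A [N [dA lA hH]]]; exists A, N; split=> //; exact: le_trans hH. Qed.

Theorem proposition5p23 (K : finFieldType) (p m : nat) :
  p \in [pchar K] -> (2 <= m)%N -> coprime m p ->
  exists (F : nat -> fieldType) (iota : forall k, {rmorphism K -> F k})
         (emb : forall k, {rmorphism F k -> F k.+1}) (n : nat -> nat),
    [/\ is_tower iota emb,
        n 0%N = 1%N /\ (forall i, 0 < n i)%N /\ (forall i, n i < n i.+1)%N,
        (forall k i, (i <= k)%N -> places_ge (iota k) (n i) (p ^ (k - i))) &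
        (forall k, genus_ge (iota k)
             ((m%:R - 1) / 2 * ((p%:R : rat) ^+ k - 1)))].
Proof.
move=> pK m_ge2 _; have p_gt1 : (1 < p)%N by exact/prime_gt1/(pcharf_prime pK).
have p_gt0 := ltnW p_gt1.
(* The starting index [m.+1] is chosen for this inequality, which holds since [m < p^m]. *)
have pm_lt : (p * m < p ^ m.+1)%N by rewrite expnS ltn_pmul2l // ltn_expl.
pose L := @tower_level K p m.+1 pK isT.
have nr k : forall z : L k, z ^+ p - z <> lev (L k) (as_poly K p (m.+1 + k)).
  exact: as_poly_no_root.
have genusL k : genus_ge (consts (lev (L k))) (m%:R * (p%:R ^+ k - 1)).
  exact: (level_genus (L k) pK isT pm_lt).
have pk1 k : (1 : rat) <= p%:R ^+ k by rewrite -natrX ler1n expn_gt0 p_gt0.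
exists (fun k => lfield (L k)), (fun k => consts (lev (L k))),
  (fun k => next_emb pK (@as_poly_no_root K p m.+1 pK isT k (L k))), (fun i => p ^ i)%N.
split.
- split; [|split; [|split]].
  + move=> k; split; first exact: level_function_field.
    exact: (level_const_closed (L := L k) pK isT pm_lt).
  + by [].
  + move=> k; split; [exact: next_finite|exact: next_separable|exact: next_proper].
  (* For [k >= G], [G <= p^k - 1 <= m (p^k - 1)]. *)
  + move=> G; exists G => k leGk; apply: genus_ge_le (genusL k).
    have leG : (G <= p ^ k - 1)%N.
      by rewrite leq_subRL ?expn_gt0 ?p_gt0 // add1n (leq_ltn_trans leGk) // ltn_expl.
    rewrite -natrX -(natrB _ (_ : 1 <= p ^ k)%N) ?expn_gt0 ?p_gt0 // -natrM ler_nat.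
    by rewrite (leq_trans leG) // leq_pmull // ltnW.
- split=> //; split=> i; first by rewrite expn_gt0 p_gt0.
  by rewrite ltn_exp2l.
- move=> k i leik; apply: (level_places (L k) pK).
  by rewrite leq_exp2l // leq_subr.
- move=> k; apply: genus_ge_le (genusL k); apply: ler_wpM2r; first by rewrite subr_ge0.
  have m_ge0 : (0 : rat) <= m%:R by rewrite ler0n.
  lra.
Qed.
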